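(* Let $\mathcal{A}$ be a non-unital non-abelian C*-algebra and $x\in\mathcal{A}$. The following are equivalent: (i) $x$ is approximately right invertible in $\mathcal{A}$; (ii) $x$ does not belong to any maximal modular right ideal of $\mathcal{A}$; (iii) $\tau(xx^* )\neq 0$ for every pure state $\tau$ of $\mathcal{A}$.
   Context: An approximate identity in $\mathcal{A}$ is a net $(e_j)_{j\in J}$ with $\lim_j e_jy=\lim_j ye_j=y$ for all $y\in\mathcal{A}$. An element $x$ is approximately right invertible if there is a net $(r_j)$ in $\mathcal{A}$ such that $(xr_j)$ is an approximate identity in $\mathcal{A}$. A right ideal $I$ is modular if there exists $v\in\mathcal{A}$ such that $vy-y\in I$ for all $y\in\mathcal{A}$; a maximal modular right ideal is a proper modular right ideal maximal among proper right ideals of $\mathcal{A}$. *)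

(* Defs.v *)
From mathcomp Require Import all_boot all_order all_algebra.
From mathcomp Require Import reals.
From mathcomp Require Import complex.
Set Implicit Arguments.
Unset Strict Implicit.
Unset Printing Implicit Defensive.
Import Order.TTheory GRing.Theory Num.Theory.
Local Open Scope ring_scope.

Section CstarDefs.
Variable R : realType.
Variable A : lmodType R[i].
Variables (mul : A -> A -> A) (star : A -> A) (nrm : A -> R).

Definition algebra_axioms : Prop :=
  [/\ (forall a b c, mul a (mul b c) = mul (mul a b) c),
      (forall a b c, mul (a + b) c = mul a c + mul b c),
      (forall a b c, mul a (b + c) = mul a b + mul a c),
      (forall (k : R[i]) a b, mul (k *: a) b = k *: mul a b) &
      (forall (k : R[i]) a b, mul a (k *: b) = k *: mul a b)].

Definition involution_axioms : Prop :=
  [/\ (forall a b, star (a + b) = star a + star b),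
      (forall (k : R[i]) a, star (k *: a) = (conjc k) *: star a),
      (forall a, star (star a) = a) &
      (forall a b, star (mul a b) = mul (star b) (star a))].

Definition cstar_norm_axioms : Prop :=
  [/\ (forall a, nrm a = 0 -> a = 0),
      (forall a b, nrm (a + b) <= nrm a + nrm b),
      (forall (k : R[i]) a, nrm (k *: a) = Normc.normc k * nrm a),
      (forall a b, nrm (mul a b) <= nrm a * nrm b) &
      (forall a, nrm (mul (star a) a) = nrm a ^+ 2)].

Definition complete_norm : Prop :=
  forall u : nat -> A,
    (forall e : R, 0 < e -> exists N : nat, forall m n : nat,
        (N <= m)%N -> (N <= n)%N -> nrm (u m - u n) < e) ->
    exists l : A, forall e : R, 0 < e -> exists N : nat, forall n : nat,
        (N <= n)%N -> nrm (u n - l) < e.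

Definition is_cstar_algebra : Prop :=
  [/\ algebra_axioms, involution_axioms, cstar_norm_axioms & complete_norm].

Definition non_unital : Prop := ~ exists e : A, forall a, mul e a = a /\ mul a e = a.

Definition non_abelian : Prop := exists a b : A, mul a b <> mul b a.

Definition directed (J : Type) (le : J -> J -> Prop) : Prop :=
  [/\ inhabited J, (forall j, le j j),
      (forall i j k, le i j -> le j k -> le i k) &
      (forall i j, exists k, le i k /\ le j k)].

Definition net_converges (J : Type) (le : J -> J -> Prop) (u : J -> A) (l : A) : Prop :=
  forall e : R, 0 < e -> exists j0 : J, forall j, le j0 j -> nrm (u j - l) < e.

Definition approx_identity (J : Type) (le : J -> J -> Prop) (e : J -> A) : Prop :=
  forall y : A, net_converges le (fun j => mul (e j) y) y /\
                net_converges le (fun j => mul y (e j)) y.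

Definition approx_right_invertible (x : A) : Prop :=
  exists (J : Type) (le : J -> J -> Prop) (r : J -> A),
    directed le /\ approx_identity le (fun j => mul x (r j)).

Definition right_ideal (I : A -> Prop) : Prop :=
  [/\ I 0, (forall a b, I a -> I b -> I (a + b)),
      (forall (k : R[i]) a, I a -> I (k *: a)) &
      (forall a y, I a -> I (mul a y))].

Definition proper_set (I : A -> Prop) : Prop := exists a, ~ I a.

Definition modular (I : A -> Prop) : Prop := exists v : A, forall y, I (mul v y - y).

Definition maximal_modular_right_ideal (I : A -> Prop) : Prop :=
  [/\ right_ideal I, proper_set I, modular I &
      forall J : A -> Prop, right_ideal J -> proper_set J ->
        (forall a, I a -> J a) -> forall a, J a -> I a].

Definition linear_functional (tau : A -> R[i]) : Prop :=
  (forall a b, tau (a + b) = tau a + tau b) /\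
  (forall (k : R[i]) a, tau (k *: a) = k * tau a).

Definition positive_functional (tau : A -> R[i]) : Prop :=
  linear_functional tau /\
  forall a, Im (tau (mul (star a) a)) = 0 /\ 0 <= Re (tau (mul (star a) a)).

Definition is_state (tau : A -> R[i]) : Prop :=
  [/\ positive_functional tau,
      (forall a, Normc.normc (tau a) <= nrm a) &
      (forall e : R, 0 < e -> exists a, nrm a <= 1 /\ 1 - e < Normc.normc (tau a))].

Definition pure_state (tau : A -> R[i]) : Prop :=
  is_state tau /\
  forall (t : R) (tau1 tau2 : A -> R[i]), 0 < t -> t < 1 ->
    is_state tau1 -> is_state tau2 ->
    (forall a, tau a = (t%:C)%C * tau1 a + ((1 - t)%:C)%C * tau2 a) ->
    forall a, tau1 a = tau a /\ tau2 a = tau a.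

End CstarDefs.

(* Main.v *)
Require Import Defs.
From mathcomp Require Import all_boot all_order all_algebra.
From mathcomp Require Import reals.
From mathcomp Require Import complex.
From HB Require Import structures.
From mathcomp Require Import boolp classical_sets ring lra.
From Stdlib Require Ncring Ncring_tac.
Import Order.TTheory GRing.Theory Num.Theory.
Local Open Scope ring_scope.

(** Let [B] be the unitization of [A], normed by the action on [A], put
    [h = x x*] with [x] scaled to norm at most 1, and let [L] be the closure of
    [x A]. All three conditions say that [L = A].

    If [L = A], then [1 - (1 - h)^n], which is a right multiple of [x], is an
    approximate identity, because the norm of [(1 - h)^n x] is at most
    [n^(-1/2)]. Moreover a modular proper right ideal keeps distance 1 from its
    modular unit, and [tau (x x* ) = 0] forces [tau = 0] on [L]; this gives (ii)
    and (iii).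

    If [L <> A], the norm of a coset of [A / L] is attained, so there is [c] in
    the unit ball of [A] with [(1 - h) c] of norm 1. Then
    [k = (1 - h) c c* (1 - h)] satisfies [0 <= k <= 1 - h] and has norm 1. An
    extreme point [tau] of the dual unit ball with [tau k = 1] is a pure state
    with [tau h = 0], and it is unchanged under multiplication by [k], so that
    [{y | tau (y A) = 0}] is a proper right ideal containing [x], with modular
    unit [k]. Both (ii) and (iii) fail. *)

Local Set Implicit Arguments.
Local Unset Strict Implicit.

(** * Preliminaries *)

(** The delicate point is the modular unit. A pure state [tau] killing [x x*] always yields the
    right ideal [{y | tau (y A) = 0}] containing [x], but its modularity is usually drawn from
    Kadison's transitivity theorem. Here it comes from a norm that is attained exactly: since [k]
    has norm 1, and not merely nearly 1, and [0 <= k <= 1], moving [k] in a direction [(1 - k) z]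
    raises its norm at most to second order, so a functional peaking at [k] cannot see [1 - k]. No
    spectrum is used: positivity is a norm inequality, square roots are limits of an explicit
    iteration, and the positivity of [y y*] is derived from these. Non-unitality enters through the
    unitization, where it makes the operator norm definite. *)

Section NoncommutativeRing.
Variable B : nzRingType.

(** This instance makes [ncring] decide the identities of the free noncommutative ring. Commutation
    relations are invisible to it, which is why several identities below carry an explicit
    commutator that is then rewritten to 0. *)
#[local] Instance nzRing_ops :
  @Ncring.Ring_ops B 0 1 (@GRing.add B) (@GRing.mul B)
    (fun x y => x - y) (@GRing.opp B) (@eq B) := {}.

#[local] Program Definition nzRing_ring :
  @Ncring.Ring _ _ _ _ _ _ _ _ nzRing_ops :=
  @Ncring.Build_Ring _ _ _ _ _ _ _ _ _ _ _ _ _ _ _ _ _ _ _ _ _ _ _ _.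
Solve Obligations with (cbv; intros; subst; auto).
Next Obligation. exact: add0r. Qed.
Next Obligation. exact: addrC. Qed.
Next Obligation. exact: addrA. Qed.
Next Obligation. exact: mul1r. Qed.
Next Obligation. exact: mulr1. Qed.
Next Obligation. exact: mulrA. Qed.
Next Obligation. exact: mulrDl. Qed.
Next Obligation. exact: mulrDr. Qed.
Next Obligation. exact: addrN. Qed.
End NoncommutativeRing.
#[local] Existing Instance nzRing_ops.
#[local] Existing Instance nzRing_ring.
Local Ltac ncring := Ncring_tac.non_commutative_ring.

Local Notation "r %:c" := (real_complex _ r) (at level 2, format "r %:c").

Lemma normc_real (R : realType) (r : R) : Normc.normc r%:c = `|r|.
Proof. by rewrite /= expr0n addr0 sqrtr_sqr. Qed.

Lemma realC_D (R : realType) (r s : R) : (r + s)%:c = r%:c + s%:c.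
Proof. exact: rmorphD. Qed.

Lemma realC_M (R : realType) (r s : R) : (r * s)%:c = r%:c * s%:c.
Proof. exact: rmorphM. Qed.

Lemma le0_of_small (R : realFieldType) (a c : R) :
  (forall e, 0 < e -> a <= c * e) -> a <= 0.
Proof.
move=> H; rewrite leNgt; apply/negP => a0.
have c0 : 0 < c by have := H 1 ltr01; rewrite mulr1; exact: lt_le_trans.
have e0 : 0 < a / (c + c) by rewrite divr_gt0 // addr_gt0.
have := H _ e0.
have -> : c * (a / (c + c)) = a / 2 by field; lra.
lra.
Qed.

Lemma ex_ltn_real (R : realType) (a : R) : exists n : nat, a < n.+1%:R.
Proof.
exists (Num.bound `|a|); apply: le_lt_trans (ler_norm a) _.
by apply: lt_le_trans (archi_boundP (normr_ge0 a)) _; rewrite ler_nat.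
Qed.

(** * Norm, involution and convergent sequences in a C*-algebra *)

Section CstarAlgebra.
Variables (R : realType) (A : lmodType R[i]).
Variables (mul : A -> A -> A) (star : A -> A) (nrm : A -> R).
Hypothesis hA : is_cstar_algebra mul star nrm.

Lemma nrm_eq0 a : nrm a = 0 -> a = 0.
Proof. by case: hA => _ _ [H _ _ _ _] _; exact: H. Qed.
Lemma nrmD a b : nrm (a + b) <= nrm a + nrm b.
Proof. by case: hA => _ _ [_ H _ _ _] _. Qed.
Lemma nrmZ k a : nrm (k *: a) = Normc.normc k * nrm a.
Proof. by case: hA => _ _ [_ _ H _ _] _. Qed.
Lemma nrmM a b : nrm (mul a b) <= nrm a * nrm b.
Proof. by case: hA => _ _ [_ _ _ H _] _. Qed.
Lemma nrmC a : nrm (mul (star a) a) = nrm a ^+ 2.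
Proof. by case: hA => _ _ [_ _ _ _ H] _. Qed.
Lemma cmulA a b c : mul a (mul b c) = mul (mul a b) c.
Proof. by case: hA => [[H _ _ _ _] _ _ _]. Qed.
Lemma cmulDl a b c : mul (a + b) c = mul a c + mul b c.
Proof. by case: hA => [[_ H _ _ _] _ _ _]. Qed.
Lemma cmulDr a b c : mul a (b + c) = mul a b + mul a c.
Proof. by case: hA => [[_ _ H _ _] _ _ _]. Qed.
Lemma cmulZl k a b : mul (k *: a) b = k *: mul a b.
Proof. by case: hA => [[_ _ _ H _] _ _ _]. Qed.
Lemma cmulZr k a b : mul a (k *: b) = k *: mul a b.
Proof. by case: hA => [[_ _ _ _ H] _ _ _]. Qed.
Lemma starD a b : star (a + b) = star a + star b.
Proof. by case: hA => [_ [H _ _ _] _ _]. Qed.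
Lemma starZ k a : star (k *: a) = conjc k *: star a.
Proof. by case: hA => [_ [_ H _ _] _ _]. Qed.
Lemma starK a : star (star a) = a. Proof. by case: hA => [_ [_ _ H _] _ _]. Qed.
Lemma starM a b : star (mul a b) = mul (star b) (star a).
Proof. by case: hA => [_ [_ _ _ H] _ _]. Qed.

Lemma starN a : star (- a) = - star a.
Proof. by rewrite -scaleN1r starZ rmorphN rmorph1 scaleN1r. Qed.
Lemma starB a b : star (a - b) = star a - star b.
Proof. by rewrite starD starN. Qed.
Lemma star0 : star 0 = 0.
Proof. by rewrite -[X in star X](subrr (0 : A)) starB subrr. Qed.
Lemma starZr (r : R) a : star (r%:c *: a) = r%:c *: star a.
Proof. by rewrite starZ conjc_real. Qed.
Lemma cmulNl a b : mul (- a) b = - mul a b.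
Proof. by rewrite -scaleN1r cmulZl scaleN1r. Qed.
Lemma cmulNr a b : mul a (- b) = - mul a b.
Proof. by rewrite -scaleN1r cmulZr scaleN1r. Qed.
Lemma cmul0 a : mul a 0 = 0.
Proof. by rewrite -[X in mul _ X](scale0r (0 : A)) cmulZr scale0r. Qed.
Lemma cmulBl a b c : mul (a - b) c = mul a c - mul b c.
Proof. by rewrite cmulDl cmulNl. Qed.
Lemma cmulBr a b c : mul a (b - c) = mul a b - mul a c.
Proof. by rewrite cmulDr cmulNr. Qed.

Lemma nrmZr (r : R) a : nrm (r%:c *: a) = `|r| * nrm a.
Proof. by rewrite nrmZ normc_real. Qed.
Lemma nrm0 : nrm 0 = 0.
Proof. by rewrite -[X in nrm X](scale0r (0 : A)) (nrmZr 0) normr0 mul0r. Qed.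
Lemma nrmN a : nrm (- a) = nrm a.
Proof. by rewrite -scaleN1r nrmZ normcN Normc.normc1 mul1r. Qed.
Lemma nrmB a b : nrm (a - b) <= nrm a + nrm b.
Proof. by rewrite -[nrm b]nrmN nrmD. Qed.
Lemma nrm_dist a b : nrm (a - b) = nrm (b - a).
Proof. by rewrite -nrmN opprB. Qed.
Lemma nrm_ge0 a : 0 <= nrm a.
Proof. by have := nrmB a a; rewrite subrr nrm0; lra. Qed.
Lemma nrm_gt0 a : a <> 0 -> 0 < nrm a.
Proof. by move=> a0; rewrite lt_def nrm_ge0 andbT; apply/eqP => /nrm_eq0. Qed.
Lemma nrm_le0 a : nrm a <= 0 -> a = 0.
Proof. by move=> H; apply: nrm_eq0; apply/eqP; rewrite eq_le H nrm_ge0. Qed.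
Lemma nrm_small a : (forall e, 0 < e -> nrm a <= e) -> a = 0.
Proof. by move=> H; apply/nrm_le0/(@le0_of_small _ _ 1) => e e0; rewrite mul1r H. Qed.

Lemma nrm_star a : nrm (star a) = nrm a.
Proof.
have H b : nrm b <= nrm (star b).
  have [->|/eqP/nrm_gt0 b0] := eqVneq b 0; first by rewrite nrm0 nrm_ge0.
  by rewrite -(ler_pM2r b0) -expr2 -nrmC nrmM.
by apply/eqP; rewrite eq_le H -{2}(starK a) H.
Qed.
Lemma nrmC' a : nrm (mul a (star a)) = nrm a ^+ 2.
Proof. by rewrite -{1}(starK a) nrmC nrm_star. Qed.

Definition cvgs (u : nat -> A) (l : A) : Prop :=
  forall e : R, 0 < e -> exists K : nat, forall n, (K <= n)%N -> nrm (u n - l) < e.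

Lemma cvgs_cst a : cvgs (fun=> a) a.
Proof. by move=> e e0; exists 0%N => n _; rewrite subrr nrm0. Qed.

Lemma cvgs_shift u l : cvgs u l -> cvgs (fun n => u n.+1) l.
Proof.
by move=> H e /H[K HK]; exists K => n Kn; apply: HK; exact: leqW.
Qed.

Lemma cvgs_add u v a b : cvgs u a -> cvgs v b -> cvgs (fun n => u n + v n) (a + b).
Proof.
move=> Hu Hv e e0; have e2 : 0 < e / 2 by lra.
have [K HK] := Hu _ e2; have [L HL] := Hv _ e2.
exists (maxn K L) => n; rewrite geq_max => /andP[/HK un /HL vn].
rewrite opprD addrACA; apply: le_lt_trans (nrmD _ _) _; lra.
Qed.

Lemma cvgs_additive (f : A -> A) (c : R) u l :
  (forall a b, f (a - b) = f a - f b) -> (forall a, nrm (f a) <= c * nrm a) ->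
  cvgs u l -> cvgs (fun n => f (u n)) (f l).
Proof.
move=> fB fc H e e0.
have c0 : 0 < `|c| + 1 by apply: ltr_wpDl => //; exact: normr_ge0.
have [K HK] := H (e / (`|c| + 1)) (divr_gt0 e0 c0).
exists K => n /HK; rewrite ltr_pdivlMr // => Hn; rewrite -fB.
apply: le_lt_trans (fc _) _; apply: le_lt_trans Hn.
rewrite mulrC ler_wpM2l ?nrm_ge0 //; apply: le_trans (ler_norm c) _; lra.
Qed.

Lemma cvgs_star u l : cvgs u l -> cvgs (fun n => star (u n)) (star l).
Proof.
by apply: (@cvgs_additive star 1) => [a b|a]; rewrite ?starB // nrm_star mul1r.
Qed.

Lemma cvgs_mull c u l : cvgs u l -> cvgs (fun n => mul c (u n)) (mul c l).
Proof. by apply: (@cvgs_additive (mul c) (nrm c)) => [a b|a]; rewrite ?cmulBr ?nrmM. Qed.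

Lemma cvgs_mulr c u l : cvgs u l -> cvgs (fun n => mul (u n) c) (mul l c).
Proof.
by apply: (@cvgs_additive (mul^~ c) (nrm c)) => [a b|a]; rewrite ?cmulBl // mulrC nrmM.
Qed.

Lemma cvgs_mul u v a b :
  cvgs u a -> cvgs v b -> cvgs (fun n => mul (u n) (v n)) (mul a b).
Proof.
move=> Hu Hv.
have H0 : cvgs (fun n => mul (u n - a) (v n - b)) 0.
  move=> e e0; have [K HK] := Hu _ e0; have [L HL] := Hv _ (@ltr01 R).
  exists (maxn K L) => n; rewrite geq_max subr0 => /andP[/HK un /HL vn].
  apply: le_lt_trans (nrmM _ _) _; apply: le_lt_trans un.
  by rewrite -[leRHS]mulr1 ler_wpM2l ?nrm_ge0 ?ltW.
have H1 := cvgs_add H0 (cvgs_add (cvgs_mulr b Hu) (cvgs_mull a Hv)).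
have H2 := cvgs_add H1 (cvgs_cst (- mul a b)).
move=> e /H2[K HK]; exists K => n /HK; congr (nrm _ < _).
rewrite add0r addrK; congr (_ - _); rewrite cmulBl !cmulBr.
move: (mul (u n) (v n)) (mul (u n) b) (mul a (v n)) (mul a b) => p q s t.
have -> : p - q - (s - t) = p - (q + s) + t.
  by rewrite opprB addrA opprD addrA [RHS]addrAC.
by rewrite [_ + t + _]addrAC subrK addrK.
Qed.

Lemma cvgs_ext u v l : (forall n, u n = v n) -> cvgs u l -> cvgs v l.
Proof. by move=> uv H e /H[K HK]; exists K => n; rewrite -uv; exact: HK. Qed.

Lemma cvgs_unique u a b : cvgs u a -> cvgs u b -> a = b.
Proof.
move=> Ha Hb; apply/subr0_eq/nrm_small => e e0; have e2 : 0 < e / 2 by lra.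
have [K HK] := Ha _ e2; have [L HL] := Hb _ e2.
have := HK _ (leq_maxl K L); have := HL _ (leq_maxr K L).
set x := u _ => Hxb Hxa.
have -> : a - b = (x - b) - (x - a) by rewrite opprB [RHS]addrC addrA subrK.
by apply: le_trans (nrmB _ _) _; lra.
Qed.

Lemma cvgs_nrm_le u l (c : R) : cvgs u l -> (forall n, nrm (u n) <= c) -> nrm l <= c.
Proof.
move=> H Hc; rewrite -subr_le0; apply/(@le0_of_small _ _ 1) => e /H[K /(_ K (leqnn _)) HK].
rewrite mul1r lerBlDl -{1}(subKr (u K) l).
by apply: le_trans (nrmB _ _) _; apply: lerD => //; exact: ltW.
Qed.

(** The bounded increasing sequence [t] comes close to its supremum, and it dominates the
    oscillation of [u]. Square roots, Neumann series, the attained coset norm and the left unit of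
    [contraction_False] are all obtained this way, with an explicit [t]. *)
Lemma cvgs_majorant (u : nat -> A) (t : nat -> R) (M : R) :
  (forall n, nrm (u n.+1 - u n) <= t n.+1 - t n) -> (forall n, t n <= M) ->
  exists l, cvgs u l.
Proof.
move=> ut tM.
have dist m d : nrm (u (m + d)%N - u m) <= t (m + d)%N - t m.
  elim: d => [|d IH]; first by rewrite addn0 !subrr nrm0.
  rewrite addnS -(subrK (u (m + d)%N) (u _)) -addrA.
  apply: le_trans (nrmD _ _) _; have := ut (m + d)%N; lra.
have tmono m d : t m <= t (m + d)%N.
  by rewrite -subr_ge0; apply: le_trans (dist m d); exact: nrm_ge0.
pose E := [set x | exists n, x = t n]%classic.
have hE : has_sup E by split; [exists (t 0%N), 0%N | exists M => _ [n ->]].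
have cauchy e : 0 < e -> exists K : nat, forall d, nrm (u (K + d)%N - u K) < e.
  move=> e0; have [_ [K ->] HK] := sup_adherent e0 hE.
  exists K => d; apply: le_lt_trans (dist _ _) _.
  have : t (K + d)%N <= sup E by apply: sup_upper_bound => //; exists (K + d)%N.
  lra.
have [_ _ _ +] := hA; apply => e e0.
have e2 : 0 < e / 2 by lra.
have [K HK] := cauchy _ e2; exists K => m n Km Kn.
have := HK (m - K)%N; have := HK (n - K)%N; rewrite !subnKC // => Hn Hm.
have -> : u m - u n = (u m - u K) - (u n - u K) by rewrite opprB addrA subrK.
by apply: le_lt_trans (nrmB _ _) _; lra.
Qed.

End CstarAlgebra.

(** * Square roots and inverses in unital C*-algebras *)

Section UnitalCstarAlgebra.
Variables (R : realType) (B : algType R[i]).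
Variables (st : B -> B) (N : B -> R).
Hypothesis hB : is_cstar_algebra *%R st N.

Lemma st1 : st 1 = 1.
Proof. by have := starM hB 1 (st 1); rewrite mul1r (starK hB) mul1r => /esym. Qed.

Lemma N1 : N 1 = 1.
Proof.
have := nrmC hB 1; rewrite st1 mulr1 => /esym/eqP.
rewrite expr2 -subr_eq0 -{3}[N 1]mulr1 -mulrBr mulf_eq0.
by rewrite subr_eq0 => /orP[/eqP/(nrm_eq0 hB)/eqP|/eqP//]; rewrite oner_eq0.
Qed.

Lemma N_sa a : st a = a -> N (a * a) = N a ^+ 2.
Proof. by move=> sa; rewrite -{1}sa (nrmC hB). Qed.

Lemma N_real (r : R) : N (r%:c *: 1) = `|r|.
Proof. by rewrite (nrmZr hB) N1 mulr1. Qed.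

Lemma st_real (r : R) : st (r%:c *: 1) = r%:c *: 1.
Proof. by rewrite (starZr hB) st1. Qed.

Lemma N_half a : N ((2^-1 : R)%:c *: a) = N a / 2.
Proof. by rewrite (nrmZr hB) ger0_norm ?invr_ge0 // mulrC. Qed.

Lemma half_double (a : B) : (2^-1 : R)%:c *: (a + a) = a.
Proof.
rewrite scalerDr -scalerDl -realC_D.
by have -> : 2^-1 + 2^-1 = 1 :> R; [field | exact: scale1r].
Qed.

(* [1 - y] with [y] the limit of y' = (x + y^2) / 2; the same recursion at
   x = 1 in the reals dominates it. *)
Lemma sqrt_1B x : N x <= 1 -> exists y,
  [/\ (1 - y) * (1 - y) = 1 - x, N y <= 1, st x = x -> st y = y &
      forall z, z * x = x * z -> z * y = y * z].
Proof.
move=> x1; pose F y := (2^-1 : R)%:c *: (x + y * y).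
pose u n := iter n F 0; pose t n := iter n (fun s : R => (1 + s * s) / 2) 0.
have t01 n : 0 <= t n <= 1.
  by elim: n => [|n] //=; rewrite ?lexx ?ler01 // -/(t n); nra.
have ut n : N (u n) <= t n.
  elim: n => [|n IH]; first by rewrite (nrm0 hB).
  rewrite [u _]/= -/(u n) N_half ler_pM2r // ?invr_gt0 //.
  apply: le_trans (nrmD hB _ _) (lerD x1 _); apply: le_trans (nrmM hB _ _) _.
  by apply: ler_pM => //; exact: nrm_ge0 hB _.
have comm z n : z * x = x * z -> z * u n = u n * z.
  move=> zx; elim: n => [|n IH]; first by rewrite mulr0 mul0r.
  rewrite [u _]/= -/(u n) -scalerAr -scalerAl; congr (_ *: _).
  by rewrite mulrDr mulrDl zx mulrA IH -mulrA IH mulrA.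
have comm2 n : u n.+1 * u n = u n * u n.+1 by apply: (comm); rewrite comm.
have ud n : N (u n.+1 - u n) <= t n.+1 - t n.
  elim: n => [|n IH].
    rewrite [u 1%N]/= [t 1%N]/= mul0r addr0 subr0 N_half mulr0 addr0 subr0.
    by rewrite ler_pM2r // invr_gt0.
  (* Consecutive iterates commute, so the increment is a factored difference of squares, and each
     factor is bounded by the matching factor for [t]. *)
  have -> : u n.+2 - u n.+1 = (2^-1 : R)%:c *: ((u n.+1 - u n) * (u n.+1 + u n)).
    have -> : (u n.+1 - u n) * (u n.+1 + u n) =
        u n.+1 * u n.+1 - u n * u n + (u n.+1 * u n - u n * u n.+1) by ncring.
    rewrite comm2 subrr addr0 [u n.+2]/= -/(u n.+1) [X in _ - X = _]/= -/(u n).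
    by rewrite -scalerBr opprD addrACA subrr add0r.
  have -> : t n.+2 - t n.+1 = (t n.+1 - t n) * (t n.+1 + t n) / 2.
    have tS m : t m.+1 = (1 + t m * t m) / 2 by [].
    by rewrite !tS; field.
  rewrite N_half ler_pM2r ?invr_gt0 //; apply: le_trans (nrmM hB _ _) _.
  apply: ler_pM; rewrite ?(nrm_ge0 hB) //.
  by apply: le_trans (nrmD hB _ _) (lerD _ _).
have [y uy] : exists y, cvgs N u y.
  by apply: (cvgs_majorant hB ud (M := 1)) => n; have /andP[] := t01 n.
exists y; split.
- have H : y + y = x + y * y.
    apply: (@cvgs_unique _ _ _ _ _ hB (fun n => u n.+1 + u n.+1)).
      exact: (cvgs_add hB (cvgs_shift uy) (cvgs_shift uy)).
    apply: (cvgs_ext (u := fun n => x + u n * u n)) => [n|].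
      by rewrite [u n.+1]/= -/(u n) -[LHS]half_double scalerDr.
    exact: (cvgs_add hB (cvgs_cst hB x) (cvgs_mul hB uy uy)).
  have -> : (1 - y) * (1 - y) = 1 - (y + y) + y * y by ncring.
  by rewrite H; ncring.
- by apply: (cvgs_nrm_le hB uy) => n; apply: le_trans (ut n) _; have /andP[] := t01 n.
- move=> sx; apply: (cvgs_unique hB _ uy).
  apply: (cvgs_ext (u := fun n => st (u n))); last exact: (cvgs_star hB uy).
  elim=> [|n IH]; first exact: (star0 hB).
  by rewrite [u _]/= -/(u n) (starZr hB) (starD hB) (starM hB) IH sx.
- move=> z zx; apply: (cvgs_unique hB (cvgs_mull hB z uy)).
  by apply: (cvgs_ext _ (cvgs_mulr hB z uy)) => n; rewrite comm.
Qed.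

(** The iterates are the partial sums of the geometric series, and [t] is the closed form of the
    real one. The fixed point is a right inverse; commuting with [x], it is also a left inverse. *)
Lemma neumann x : N x < 1 -> exists u, [/\ (1 - x) * u = 1, u * (1 - x) = 1 &
  forall z, z * x = x * z -> z * u = u * z].
Proof.
move=> x1; pose u n := iter n (fun s => 1 + x * s) 0.
have N0 := nrm_ge0 hB x; have x2 : 0 < 1 - N x by rewrite subr_gt0.
pose t n := (1 - N x ^+ n) / (1 - N x).
have comm z n : z * x = x * z -> z * u n = u n * z.
  move=> zx; elim: n => [|n IH]; first by rewrite mulr0 mul0r.
  by rewrite [u _]/= -/(u n) mulrDr mulrDl mulr1 mul1r mulrA zx -!mulrA IH.
have ud n : N (u n.+1 - u n) <= t n.+1 - t n.
  have -> : t n.+1 - t n = N x ^+ n by rewrite /t exprS; field; rewrite gt_eqF.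
  elim: n => [|n IH]; first by rewrite /= mulr0 addr0 subr0 N1.
  have -> : u n.+2 - u n.+1 = x * (u n.+1 - u n).
    have -> : u n.+2 - u n.+1 = (1 + x * u n.+1) - (1 + x * u n) by [].
    by ncring.
  rewrite exprS; apply: le_trans (nrmM hB _ _) _; exact: ler_wpM2l.
have [y uy] : exists y, cvgs N u y.
  apply: (cvgs_majorant hB ud (M := (1 - N x)^-1)) => n.
  rewrite /t -[leRHS]mul1r ler_pM2r ?invr_gt0 // gerBl; exact: exprn_ge0.
have cy z : z * x = x * z -> z * y = y * z.
  move=> zx; apply: (cvgs_unique hB (cvgs_mull hB z uy)).
  by apply: (cvgs_ext _ (cvgs_mulr hB z uy)) => n; rewrite comm.
have H : y = 1 + x * y.
  apply: (cvgs_unique hB (cvgs_shift uy)).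
  exact: (cvgs_add hB (cvgs_cst hB 1) (cvgs_mull hB x uy)).
have H1 : (1 - x) * y = 1 by rewrite mulrBl mul1r {1}H addrK.
exists y; split => //.
by rewrite -cy // mulrBl mulrBr mul1r mulr1.
Qed.

End UnitalCstarAlgebra.

(** * Positive elements *)

Section Positivity.
Variables (R : realType) (B : algType R[i]).
Variables (st : B -> B) (N : B -> R).
Hypothesis hB : is_cstar_algebra *%R st N.

Local Notation "r %:S" := (r%:c *: (1 : B)) (at level 2, format "r %:S").

(* For self-adjoint [b] this says that the spectrum lies in [0, 2m]. *)
Definition pos (b : B) : Prop := st b = b /\ exists m : R, N (m%:S - b) <= m.

Lemma real1 : 1%:S = 1. Proof. exact: scale1r. Qed.
Lemma realD (r s : R) : (r + s)%:S = r%:S + s%:S.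
Proof. by rewrite realC_D scalerDl. Qed.
Lemma realZ (r s : R) : r%:c *: s%:S = (r * s)%:S.
Proof. by rewrite scalerA realC_M. Qed.
Lemma real_mull (r : R) a : r%:S * a = r%:c *: a.
Proof. by rewrite -scalerAl mul1r. Qed.
Lemma scale_natr n (a : B) : (n%:R : R)%:c *: a = a *+ n.
Proof. by rewrite rmorph_nat scaler_nat. Qed.
Lemma real_comm (r : R) a : a * r%:S = r%:S * a.
Proof. by rewrite real_mull -scalerAr mulr1. Qed.

Lemma pos_large b (M : R) : pos b -> exists2 m : R, M <= m & N (m%:S - b) <= m.
Proof.
move=> [_ [m Hm]]; exists (m + `|M|).
  by have := ler_norm M; have := le_trans (nrm_ge0 hB _) Hm; lra.
rewrite realD addrAC; apply: le_trans (nrmD hB _ _) (lerD Hm _).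
by rewrite (N_real hB) normr_id.
Qed.

Lemma posD a b : pos a -> pos b -> pos (a + b).
Proof.
move=> [sa [m Hm]] [sb [n Hn]]; split; first by rewrite (starD hB) sa sb.
exists (m + n); rewrite realD opprD addrACA.
exact: le_trans (nrmD hB _ _) (lerD Hm Hn).
Qed.

Lemma posZ (r : R) a : 0 <= r -> pos a -> pos (r%:c *: a).
Proof.
move=> r0 [sa [m Hm]]; split; first by rewrite (starZr hB) sa.
exists (r * m); rewrite -realZ -scalerBr (nrmZr hB) ger0_norm //.
exact: ler_wpM2l.
Qed.

Lemma pos_real (r : R) : 0 <= r -> pos r%:S.
Proof.
move=> r0; split; first exact: st_real hB _.
by exists r; rewrite subrr (nrm0 hB).
Qed.

Lemma pos0 : pos 0.
Proof. by have := pos_real (lexx 0); rewrite scale0r. Qed.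

Lemma pos1 : pos 1.
Proof. by have := pos_real ler01; rewrite real1. Qed.

Lemma posMn n a : pos a -> pos (a *+ n).
Proof. by move=> pa; rewrite -scale_natr; apply: posZ. Qed.

Lemma pos_realB (m : R) b : st b = b -> N b <= m -> pos (m%:S - b).
Proof.
move=> sb Nb; split; first by rewrite (starB hB) (st_real hB) sb.
by exists m; rewrite opprB addrC subrK.
Qed.

Lemma pos_1B b : st b = b -> N b <= 1 -> pos (1 - b).
Proof. by move=> sb Nb; rewrite -real1; exact: pos_realB. Qed.

(** A positive witness [m] turns [b] into [m (1 - x)] with [N x <= 1], so [sqrt_1B] applies. The
    commutation clause takes the place of functional calculus: it lets roots of commuting elements
    commute. *)
Lemma pos_sqrt b : pos b -> exists c,
  [/\ pos c, c * c = b & forall z, z * b = b * z -> z * c = c * z].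
Proof.
move=> pb; have [m m1 Hm] := pos_large 1 pb; have [sb _] := pb.
have m0 : 0 < m by lra.
pose x := m^-1%:c *: (m%:S - b).
have ex : 1 - x = m^-1%:c *: b.
  by rewrite /x scalerBr realZ mulVf ?gt_eqF // real1 subKr.
have x1 : N x <= 1.
  by rewrite (nrmZr hB) ger0_norm ?invr_ge0 ?(ltW m0) // mulrC ler_pdivrMr // mul1r.
have sx : st x = x by rewrite (starZr hB) (starB hB) (st_real hB) sb.
have [y [y2 y1 /(_ sx) sy cy]] := sqrt_1B hB x1.
exists ((Num.sqrt m)%:c *: (1 - y)); split.
- split; first by rewrite (starZr hB) (starB hB) (st1 hB) sy.
  exists (Num.sqrt m); rewrite -scalerBr subKr (nrmZr hB) ger0_norm ?sqrtr_ge0 //.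
  by rewrite -[leRHS]mulr1 ler_wpM2l ?sqrtr_ge0.
- rewrite -scalerAl -scalerAr scalerA -realC_M y2 ex scalerA -realC_M -expr2.
  by rewrite sqr_sqrtr ?ltW // divff ?gt_eqF // [LHS]scale1r.
- move=> z zb; rewrite -scalerAr -scalerAl; congr (_ *: _).
  have /cy zy : z * x = x * z.
    by rewrite -scalerAr -scalerAl mulrBr mulrBl real_comm zb.
  by rewrite mulrBr mulrBl mulr1 mul1r zy.
Qed.

(* [c + i s] is normal with [(c + i s) (c - i s) = c^2 + s^2]. *)
Lemma N_sq_le c s : st c = c -> st s = s -> c * s = s * c ->
  N (c * c) <= N (c * c + s * s).
Proof.
move=> sc ss cs; pose v := 'i%C *: s; pose u := c + v.
have sv : st v = - v.
  rewrite (starZ hB) ss -scaleNr; congr (_ *: _); apply/eqP.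
  by rewrite eq_complex /= oppr0 !eqxx.
have vv : v * v = - (s * s).
  by rewrite -scalerAl -scalerAr scalerA -expr2 sqr_i scaleN1r.
have vc : v * c = c * v by rewrite -scalerAl -scalerAr cs.
have us : u * st u = c * c + s * s.
  have -> : u * st u = c * c - v * v + (v * c - c * v).
    by rewrite /u (starD hB) sc sv; ncring.
  by rewrite vv vc subrr addr0 opprK.
rewrite -us (nrmC' hB) (N_sa hB sc).
have -> : c = (2^-1 : R)%:c *: (u + st u).
  have -> : u + st u = c + c by rewrite /u (starD hB) sc sv; ncring.
  by rewrite half_double.
rewrite ler_sqr ?nnegrE ?(nrm_ge0 hB) // (N_half hB) ler_pdivrMr //.
by apply: le_trans (nrmD hB _ _) _; rewrite (nrm_star hB); lra.
Qed.

(** After scaling to norm at most 1, [1 - a a] is the square of a self-adjoint [1 - y] commuting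
    with [a]. By [N_sq_le] its norm is at most that of [(1 - y)^2 + a^2 = 1], which is positivity
    with witness 1. *)
Lemma pos_sq a : st a = a -> pos (a * a).
Proof.
have small b : st b = b -> N b <= 1 -> pos (b * b).
  move=> sb b1; have sbb : st (b * b) = b * b by rewrite (starM hB) sb.
  split=> //; exists 1; rewrite real1.
  have b2 : N (b * b) <= 1.
    by rewrite (N_sa hB) // expr_le1 // (nrm_ge0 hB).
  have [y [y2 _ /(_ sbb) sy cy]] := sqrt_1B hB b2.
  have bcy : b * y = y * b by apply: cy; rewrite mulrA.
  have s1y : st (1 - y) = 1 - y by rewrite (starB hB) (st1 hB) sy.
  have := N_sq_le s1y sb; rewrite y2 subrK (N1 hB); apply.
  by rewrite mulrBr mulrBl mulr1 mul1r bcy.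
move=> sa; pose M := 1 + N a; have N0 := nrm_ge0 hB a.
have M0 : 0 < M by rewrite /M; lra.
have -> : a * a = (M * M)%:c *: ((M^-1%:c *: a) * (M^-1%:c *: a)).
  rewrite -scalerAl -scalerAr !scalerA -!realC_M.
  by have -> : M * M * M^-1 * M^-1 = 1; [by field; rewrite gt_eqF | rewrite [RHS]scale1r].
apply: posZ; first by rewrite mulr_ge0 // ltW.
apply: small; first by rewrite (starZr hB) sa.
rewrite (nrmZr hB) ger0_norm ?invr_ge0 ?(ltW M0) // mulrC ler_pdivrMr // mul1r /M; lra.
Qed.

Lemma posM a b : pos a -> pos b -> a * b = b * a -> pos (a * b).
Proof.
move=> pa pb ab; have [c [[sc _] ea cc]] := pos_sqrt pa.
have [d [[sd _] eb dd]] := pos_sqrt pb.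
have cd : c * d = d * c by apply: dd; apply/esym/cc; rewrite ab.
have -> : a * b = (c * d) * (c * d).
  rewrite -ea -eb.
  by rewrite -[LHS]mulrA [c * (d * d)]mulrA [in LHS]cd !mulrA.
by apply: pos_sq; rewrite (starM hB) sc sd cd.
Qed.

Lemma posX a n : pos a -> pos (a ^+ n).
Proof.
move=> pa; elim: n => [|n IH]; first exact: pos1.
by rewrite exprS; apply: posM => //; rewrite -exprS -exprSr.
Qed.

(** Both [b] and [m - b] are squares of commuting self-adjoint elements, and the two squares add up
    to the scalar [m]; [N_sq_le] concludes. This turns order bounds into norm bounds. *)
Lemma pos_N_le (m : R) b : 0 <= m -> pos b -> pos (m%:S - b) -> N b <= m.
Proof.
move=> m0 pb pmb; have [c [[sc _] eb cc]] := pos_sqrt pb.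
have [d [[sd _] emb dd]] := pos_sqrt pmb.
have cd : c * d = d * c.
  apply: dd; rewrite mulrBr mulrBl real_comm; congr (_ - _).
  exact/esym/cc.
have := N_sq_le sc sd cd; rewrite eb emb addrC subrK (N_real hB).
by rewrite ger0_norm.
Qed.

Lemma pos_N_le1 b : pos b -> pos (1 - b) -> N b <= 1.
Proof. by move=> pb p1b; apply: pos_N_le; rewrite ?real1. Qed.

Lemma pos_mono a b : pos a -> pos (b - a) -> N a <= N b.
Proof.
move=> pa pba; apply: pos_N_le => //; first exact: nrm_ge0 hB _.
have -> : (N b)%:S - a = ((N b)%:S - b) + (b - a) by rewrite addrA subrK.
apply: posD => //; apply: pos_realB => //.
by have [+ _] := posD pa pba; rewrite addrC subrK.
Qed.

Lemma powB_comm (b : B) n : (1 - b) ^+ n * b = b * (1 - b) ^+ n.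
Proof.
elim: n => [|n IH]; first by rewrite mulr1 mul1r.
rewrite exprS -mulrA IH mulrA mulrA; congr (_ * _).
by rewrite mulrBl mulrBr mulr1 mul1r.
Qed.

Lemma pos_pow_mul b n : pos b -> pos (1 - b) -> pos ((1 - b) ^+ n * b).
Proof. by move=> pb p1; apply: posM (powB_comm _ _) => //; exact: posX. Qed.

(** The operator form of [n (1 - s)^n s <= 1] on [[0, 1]]: [1 - (1 - b)^n] is the sum of the
    [(1 - b)^i b] for [i < n], each of which dominates [(1 - b)^n b]. The induction [T] is this
    estimate. *)
Lemma N_pow_mul b n : pos b -> pos (1 - b) -> n%:R * N ((1 - b) ^+ n * b) <= 1.
Proof.
move=> pb p1; pose p k := (1 - b) ^+ k.
have pp k : pos (p k) by exact: posX.
have T k : pos (1 - p k - (p k * b) *+ k).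
  elim: k => [|k IH]; first by rewrite /p expr0 mulr0n subr0 subrr; exact: pos0.
  have -> : 1 - p k.+1 - (p k.+1 * b) *+ k.+1 =
      (1 - p k - (p k * b) *+ k) + (p k * b * b) *+ k.+1.
    rewrite {1 2}/p exprSr -/(p k) mulrBr mulr1 mulrBl mulrnBl [_ *+ k.+1]mulrSr.
    by ncring.
  apply: posD => //; apply: posMn; rewrite -mulrA; apply: posM => //.
    exact: posM.
  by rewrite mulrA powB_comm -!mulrA -powB_comm.
have -> : n%:R * N ((1 - b) ^+ n * b) = N ((p n * b) *+ n).
  by rewrite -scale_natr (nrmZr hB) ger0_norm.
apply: pos_N_le1; first by apply: posMn; exact: pos_pow_mul.
have -> : 1 - p n * b *+ n = (1 - p n - (p n * b) *+ n) + p n by ncring.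
exact: posD.
Qed.

Lemma archi_le0 (a c : R) : (forall n : nat, n%:R * a <= c) -> a <= 0.
Proof.
move=> H; rewrite leNgt; apply/negP => a0.
have [n] := ex_ltn_real (c / a); rewrite ltr_pdivrMr // => Hn.
by have := lt_le_trans Hn (H n.+1); rewrite ltxx.
Qed.

(* The identity [y (1 - y*y)^n = (1 - yy* )^n y] compares a decaying power on
   the left with a growing one on the right. *)
Lemma starM_neg_eq0 y : pos (st y * y) -> pos (- (y * st y)) -> y = 0.
Proof.
have small z : N z <= 1 -> pos (st z * z) -> pos (- (z * st z)) -> z = 0.
  move=> z1; set b := st z * z; set W := - _ => pb pW.
  have p1b : pos (1 - b).
    apply: pos_1B; first by case: pb.
    by rewrite (nrmC hB) expr_le1 // (nrm_ge0 hB).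
  have N1b n : N ((1 - b) ^+ n) <= 1.
    elim: n => [|n IH]; first by rewrite (N1 hB).
    rewrite exprS; apply: le_trans (nrmM hB _ _) _; rewrite -[leRHS]mulr1.
    apply: ler_pM; rewrite ?(nrm_ge0 hB) // pos_N_le1 //.
    by rewrite opprB addrC subrK.
  have pW1 n : pos ((1 + W) ^+ n * W - W).
    elim: n => [|n IH]; first by rewrite mul1r subrr; exact: pos0.
    have -> : (1 + W) ^+ n.+1 * W - W = ((1 + W) ^+ n * W - W) + (1 + W) ^+ n * (W * W).
      by rewrite exprSr; ncring.
    have Wc m : (1 + W) ^+ m * W = W * (1 + W) ^+ m.
      elim: m => [|m IHm]; first by rewrite mulr1 mul1r.
      by rewrite exprS -mulrA IHm !mulrA; congr (_ * _); ncring.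
    apply: posD => //; apply: posM.
    - by apply: posX; apply: posD => //; exact: pos1.
    - exact: posM.
    - by rewrite mulrA Wc -!mulrA Wc.
  have zb n : z * (1 - b) ^+ n * st z = - ((1 + W) ^+ n * W).
    have -> : z * (1 - b) ^+ n = (1 + W) ^+ n * z.
      elim: n => [|n IH]; first by rewrite mulr1 mul1r.
      rewrite !exprS mulrA -mulrA -mulrA -IH mulrA mulrA; congr (_ * _).
      by rewrite /W /b; ncring.
    by rewrite /W; ncring.
  (* [W] lies below [(1 + W)^n W], which is [- z (1 - b)^n z*] and so has norm at most that of
     [z (1 - b)^n]. The C*-identity bounds the square of the latter by the norm of [(1 - b)^n b],
     which is at most [1/n]. *)
  have H n : N W ^+ 2 <= N ((1 - b) ^+ n * b).
    have : N W <= N (z * (1 - b) ^+ n).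
      apply: le_trans (pos_mono pW (pW1 n)) _; rewrite -(nrmN hB) -zb.
      apply: le_trans (nrmM hB _ _) _; rewrite (nrm_star hB) -[leRHS]mulr1.
      by apply: ler_wpM2l => //; exact: nrm_ge0 hB _.
    rewrite -ler_sqr ?nnegrE ?(nrm_ge0 hB) // => /le_trans; apply.
    rewrite -(nrmC hB) (starM hB); have [-> _] := posX n p1b.
    have -> : (1 - b) ^+ n * st z * (z * (1 - b) ^+ n) = (1 - b) ^+ n * b * (1 - b) ^+ n.
      by rewrite /b !mulrA.
    apply: le_trans (nrmM hB _ _) _; rewrite -[leRHS]mulr1.
    by apply: ler_wpM2l => //; exact: nrm_ge0 hB _.
  have W0 : N W ^+ 2 <= 0.
    apply: (@archi_le0 _ 1) => n; apply: le_trans (N_pow_mul n pb p1b).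
    by apply: ler_wpM2l.
  have {}W0 : W = 0.
    by apply: (nrm_eq0 hB); apply/eqP; rewrite -sqrf_eq0 eq_le W0 sqr_ge0.
  apply: (nrm_eq0 hB); apply/eqP; rewrite -sqrf_eq0 -(nrmC' hB).
  by rewrite -(nrmN hB) -/W W0 (nrm0 hB).
move=> p1 p2; pose r := (1 + N y)^-1; have N0 := nrm_ge0 hB y.
have r0 : 0 < r by rewrite invr_gt0; lra.
have : r%:c *: y = 0.
  apply: small.
  - by rewrite (nrmZr hB) gtr0_norm // mulrC ler_pdivrMr; lra.
  - rewrite (starZr hB) -scalerAl -scalerAr scalerA -realC_M.
    by apply: posZ => //; rewrite mulr_ge0 // ltW.
  - rewrite (starZr hB) -scalerAl -scalerAr scalerA -realC_M -scalerN.
    by apply: posZ => //; rewrite mulr_ge0 // ltW.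
move=> /eqP; rewrite scaler_eq0 => /orP[/eqP[]|/eqP //].
by move=> r1; rewrite r1 ltxx in r0.
Qed.

End Positivity.

(** * Positivity of [y y*], convexity of the norm, inverses of positive elements *)

Section Kaplansky.
Variables (R : realType) (B : algType R[i]).
Variables (st : B -> B) (N : B -> R).
Hypothesis hB : is_cstar_algebra *%R st N.
Local Notation pos := (pos st N).
Local Notation "r %:S" := (r%:c *: (1 : B)) (at level 2, format "r %:S").

(* With [b = y y*], [c = |b| - b] and [z = c y] one has [z z* = - |b| c^2 <= 0];
   then [z* z >= 0] because [z z* + z* z] is a sum of two squares, so [z = 0],
   which forces [c = 0]. *)
Lemma pos_mul_star y : pos (y * st y).
Proof.
set b := y * st y; have sb : st b = b by rewrite (starM hB) (starK hB).
have [r [pr rr rc]] := pos_sqrt hB (pos_sq hB sb).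
have [sr _] := pr.
have rb : b * r = r * b by apply: rc; rewrite mulrA.
pose c := r - b; have sc : st c = c by rewrite (starB hB) sr sb.
pose z := c * y.
have cb : c * b = - (r * c).
  by rewrite /c mulrBl mulrBr rr opprB.
have crc : r * c = c * r by rewrite /c mulrBl mulrBr rb.
have zz : - (z * st z) = r * (c * c).
  have -> : z * st z = c * b * c by rewrite /z (starM hB) sc /b !mulrA.
  by rewrite cb mulNr opprK mulrA.
have pzz : pos (- (z * st z)).
  rewrite zz; apply: (posM hB) => //; first exact: (pos_sq hB).
  by rewrite mulrA crc -!mulrA crc.
have pzz' : pos (st z * z).
  pose P := z + st z; pose Q := 'i%C *: (z - st z).
  have sP : st P = P by rewrite (starD hB) (starK hB) addrC.
  have sQ : st Q = Q.
    rewrite (starZ hB) (starB hB) (starK hB) -opprB scalerN -scaleNr.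
    by congr (_ *: _); apply/eqP; rewrite eq_complex /= oppr0 opprK !eqxx.
  have QQ : Q * Q = - ((z - st z) * (z - st z)).
    by rewrite -scalerAl -scalerAr scalerA -expr2 sqr_i scaleN1r.
  rewrite -(half_double (st z * z)); apply: (posZ hB); first by rewrite invr_ge0.
  have -> : st z * z + st z * z = P * P + Q * Q + (- (z * st z) - z * st z).
    by rewrite QQ /P; ncring.
  by do !apply: (posD hB) => //; exact: (pos_sq hB).
have z0 := starM_neg_eq0 hB pzz' pzz.
have cb0 : c * b = 0 by rewrite /b mulrA -/z z0 mul0r.
have rc0 : r * c = 0 by apply/eqP; rewrite -oppr_eq0 -cb cb0.
have c0 : c = 0.
  apply: (nrm_eq0 hB); apply/eqP; rewrite -sqrf_eq0 -(N_sa hB sc).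
  by rewrite {1}/c mulrBl rc0 sub0r -[b * c](starK hB)
     (starM hB) sc sb cb0 (star0 hB) oppr0 (nrm0 hB).
by rewrite -(subr0_eq c0).
Qed.

Lemma pos_star_mul y : pos (st y * y).
Proof. by rewrite -{2}(starK hB y); exact: pos_mul_star. Qed.

Lemma pos_conj b y : pos b -> pos (st y * b * y).
Proof.
move=> /(pos_sqrt hB)[c [[sc _] <- _]].
have -> : st y * (c * c) * y = st (c * y) * (c * y).
  by rewrite (starM hB) sc !mulrA.
exact: pos_star_mul.
Qed.

Lemma pos_conj_sa b y : st y = y -> pos b -> pos (y * b * y).
Proof. by move=> sy /(pos_conj y); rewrite sy. Qed.

(* The defect in this convexity inequality is [(a - c)* g (1 - g) (a - c)]. *)
Lemma N_convex g a c : pos g -> pos (1 - g) ->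
  N (g * a + (1 - g) * c) ^+ 2 <= N (st a * g * a + st c * (1 - g) * c).
Proof.
move=> pg p1g; rewrite -(nrmC hB); apply: (pos_mono hB); first exact: pos_star_mul.
have -> : st a * g * a + st c * (1 - g) * c -
    st (g * a + (1 - g) * c) * (g * a + (1 - g) * c) =
    st (a - c) * (g * (1 - g)) * (a - c).
  have [sg _] := pg.
  by rewrite (starD hB) !(starM hB) !(starB hB) (st1 hB) sg; ncring.
by apply/pos_conj/(posM hB) => //; ncring.
Qed.

Lemma N_mul_convex g c : pos g -> pos (1 - g) ->
  N ((1 - g) * c) ^+ 2 <= N (st c * (1 - g) * c).
Proof.
by move=> pg p1g; have := N_convex 0 c pg p1g; rewrite !mulr0 !add0r.
Qed.

(** With [m] a witness for [y], [e + y = (e + m) (1 - x)] where [N x < 1], so the Neumann series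
    inverts it. Then [u = u (e + y) u] is positive, and [1 - e u = y u >= 0] gives the norm
    bound. *)
Lemma pos_inv y (e : R) : 0 < e -> pos y -> exists u,
  [/\ u * (e%:S + y) = 1, (e%:S + y) * u = 1, pos u, y * u = u * y &
      N (e%:c *: u) <= 1].
Proof.
move=> e0 py; have [m m0 Hm] := pos_large hB 0 py; have [sy _] := py.
have em : 0 < e + m by lra.
pose x := (e + m)^-1%:c *: (m%:S - y).
have x1 : N x < 1.
  rewrite (nrmZr hB) gtr0_norm ?invr_gt0 // mulrC ltr_pdivrMr // mul1r.
  by apply: le_lt_trans Hm _; lra.
have eD : e%:S + y = (e + m)%:c *: (1 - x).
  rewrite scalerBr /x scalerA -realC_M mulfV ?gt_eqF // [X in _ - X]scale1r.
  by rewrite realD; ncring.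
have [v [v1 v2 cv]] := neumann hB x1.
pose u := (e + m)^-1%:c *: v.
have u1 : (e%:S + y) * u = 1.
  rewrite eD /u -scalerAl -scalerAr v1 realZ ?mulfV ?gt_eqF //; exact: real1.
have u2 : u * (e%:S + y) = 1.
  rewrite eD /u -scalerAl -scalerAr v2 realZ ?mulVf ?gt_eqF //; exact: real1.
have su : st u = u.
  rewrite -[LHS]mulr1 -u1 mulrA.
  have -> : st u * (e%:S + y) = 1.
    by rewrite -{1}sy -{1}(st_real hB) -(starD hB) -(starM hB) u1 (st1 hB).
  by rewrite mul1r.
have pu : pos u.
  rewrite -[u]mulr1 -u1 mulrA; apply: pos_conj_sa => //.
  by apply: (posD hB) => //; apply: (pos_real hB); exact: ltW.
have yu : y * u = u * y.
  have : (e%:S + y) * u = u * (e%:S + y) by rewrite u1 u2.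
  by rewrite mulrDl mulrDr real_comm => H; exact: addrI H.
exists u; split=> //; apply: (pos_N_le1 hB); first by apply: (posZ hB) => //; exact: ltW.
have -> : 1 - e%:c *: u = y * u by rewrite -{1}u1 mulrDl real_mull addrC addKr.
exact: (posM hB).
Qed.

End Kaplansky.

(** * The closed right ideal generated by an element *)

Section Approximation.
Variables (R : realType) (B : algType R[i]).
Variables (st : B -> B) (N : B -> R).
Hypothesis hB : is_cstar_algebra *%R st N.
Local Notation pos := (pos st N).
Local Notation "r %:S" := (r%:c *: (1 : B)) (at level 2, format "r %:S").

(** Closed, two-sided and self-adjoint; stability under scalars comes from multiplying by multiples
    of 1. It will be the copy of [A] in its unitization, and keeps constructions that use the unit
    inside [A]. *)
Definition closed_ideal (J : B -> Prop) : Prop :=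
  [/\ forall a b, J a -> J b -> J (a + b), forall a b, J b -> J (a * b),
      forall a b, J a -> J (a * b), forall a, J a -> J (st a) &
      forall u l, cvgs N u l -> (forall n, J (u n)) -> J l].

Variable x : B.
Hypothesis x1 : N x <= 1.
Let h := x * st x.
(** [1 - G n] is a right multiple of [x], and [G n] contracts and tends to 0 on [x B]. Hence
    [N (G n * a)] decreases to the norm of [a] modulo the closure of [x B], which is how quotient
    norms are expressed below. *)
Definition defect n : B := (1 - x * st x) ^+ n.
Local Notation G := defect.

Lemma pos_h : pos h. Proof. exact: (pos_mul_star hB). Qed.

Lemma pos_1Bh : pos (1 - h).
Proof.
apply: (pos_1B hB); first by case: pos_h.
by rewrite (nrmC' hB) expr_le1 // (nrm_ge0 hB).
Qed.

Lemma pos_defect n : pos (G n). Proof. apply: (posX hB); exact: pos_1Bh. Qed.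

Lemma N_defect n : N (G n) <= 1.
Proof.
have N1h : N (1 - h) <= 1.
  by apply: (pos_N_le1 hB pos_1Bh); rewrite subKr; exact: pos_h.
elim: n => [|n IH]; first by rewrite /G (N1 hB).
rewrite /G exprS; apply: le_trans (nrmM hB _ _) _; rewrite -[leRHS]mulr1.
by apply: ler_pM; rewrite ?(nrm_ge0 hB).
Qed.

Lemma pos_1B_defect n : pos (1 - G n).
Proof.
by apply: (pos_1B hB) (N_defect n); case: (pos_defect n).
Qed.

Lemma N_defect_mul_le n m a : (n <= m)%N -> N (G m * a) <= N (G n * a).
Proof.
move=> nm; rewrite -(subnK nm) /G exprD -mulrA -/(G n) -/(G _).
apply: le_trans (nrmM hB _ _) _; rewrite -[leRHS]mul1r.
by apply: ler_wpM2r; [exact: nrm_ge0 hB _ | exact: N_defect].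
Qed.

(** The C*-identity turns the square into the norm of [G n h G n], at most that of [G n h], to which
    [N_pow_mul] applies. *)
Lemma N_defect_x n : n%:R * N (G n * x) ^+ 2 <= 1.
Proof.
apply: le_trans _ (N_pow_mul hB n pos_h pos_1Bh); apply: ler_wpM2l => //.
rewrite -(nrmC' hB) (starM hB); have [-> _] := pos_defect n.
rewrite mulrA -[G n * x * st x]mulrA; apply: le_trans (nrmM hB _ _) _.
rewrite -[leRHS]mulr1; apply: ler_wpM2l; [exact: nrm_ge0 hB _ | exact: N_defect].
Qed.

Lemma defect_small (e : R) c : 0 < e -> exists K, forall n, (K <= n)%N ->
  N (G n * (x * c)) < e.
Proof.
move=> e0; have c0 := nrm_ge0 hB c.
pose d := e / (1 + N c); have d0 : 0 < d by rewrite divr_gt0 //; lra.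
have [K HK] := ex_ltn_real (d ^+ 2)^-1; exists K.+1 => n Kn.
apply: le_lt_trans (N_defect_mul_le _ Kn) _; rewrite mulrA.
have d2 : 0 < d ^+ 2 by rewrite exprn_gt0.
have lt_d : N (G K.+1 * x) < d.
  rewrite -ltr_sqr ?nnegrE ?(nrm_ge0 hB) ?ltW //.
  have := N_defect_x K.+1; rewrite -ler_pdivlMl ?ltr0n // mulr1 => /le_lt_trans; apply.
  by rewrite -[ltRHS]invrK ltf_pV2 ?posrE ?invr_gt0 // ltr0n.
apply: le_lt_trans (nrmM hB _ _) _.
apply: le_lt_trans (_ : d * N c < e); first by apply: ler_wpM2r => //; exact: ltW.
rewrite /d mulrAC ltr_pdivrMr; last lra.
by rewrite ltr_pM2l //; lra.
Qed.

Definition approx_inv n : B := st x * \sum_(i < n) (1 - x * st x) ^+ i.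

Lemma mul_approx_inv n : x * approx_inv n = 1 - G n.
Proof.
by rewrite -[RHS]opprB /G subrX1 /approx_inv; ncring.
Qed.

Lemma defect_cvg_dense y : (forall e, 0 < e -> exists r, N (x * r - y) < e) ->
  cvgs N (fun n => (1 - G n) * y) y.
Proof.
move=> H e e0; have e2 : 0 < e / 2 by lra.
have [r Hr] := H _ e2; have [K HK] := defect_small r e2.
exists K => n /HK Hn.
have -> : (1 - G n) * y - y = G n * (x * r - y) - G n * (x * r) by ncring.
apply: le_lt_trans (nrmB hB _ _) _.
have : N (G n * (x * r - y)) <= N (x * r - y).
  apply: le_trans (nrmM hB _ _) _; rewrite -[leRHS]mul1r.
  by apply: ler_wpM2r; [exact: nrm_ge0 hB _ | exact: N_defect].
lra.
Qed.

(* [a] has norm 1 modulo the closed right ideal generated by [x]. *)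
Definition coset_norm1 a : Prop :=
  (forall n, 1 <= N (G n * a)) /\
  (forall d : R, 0 < d -> exists n, N (G n * a) <= 1 + d).

Lemma coset_norm1D a c : coset_norm1 a -> coset_norm1 (a + x * c).
Proof.
move=> [lo up]; split=> [n|d d0].
  rewrite -subr_le0; apply: (@le0_of_small _ _ 1) => e e0; rewrite mul1r.
  have [K HK] := defect_small c e0; have := HK _ (leq_maxl K n).
  have := N_defect_mul_le (a + x * c) (leq_maxr K n).
  have := lo (maxn K n); set m := maxn K n.
  have -> : G m * a = G m * (a + x * c) - G m * (x * c) by ncring.
  by have := nrmB hB (G m * (a + x * c)) (G m * (x * c)); lra.
have d2 : 0 < d / 2 by lra.
have [n Hn] := up _ d2; have [K HK] := defect_small c d2.
exists (maxn K n); have := HK _ (leq_maxl K n).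
have := N_defect_mul_le a (leq_maxr K n).
have := nrmD hB (G (maxn K n) * a) (G (maxn K n) * (x * c)).
by rewrite -mulrDr; lra.
Qed.

(* With [g = (1 - h)^(2n)] and [y = 1 + d - a* g a >= 0], damping the part of
   [a] lying in the ideal by [f = y / (e + y)] gives a representative
   [g a + (1 - g) a f] of squared norm at most [1 + d], at distance at most
   [sqrt e] from [a]. *)
Lemma coset_norm1_step (J : B -> Prop) (e d : R) a : closed_ideal J ->
  0 < e -> 0 < d -> J a -> N a ^+ 2 <= 1 + e -> coset_norm1 a ->
  exists b, [/\ J b, N b ^+ 2 <= 1 + d, N (b - a) ^+ 2 <= e & coset_norm1 b].
Proof.
move=> [JD Jl Jr _ _] e0 d0 Ja Na la.
have [n Hn] : exists n, N (G n * a) ^+ 2 <= 1 + d.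
  (* Chosen so that [(1 + s)^2 = 1 + d]. *)
  pose s := Num.sqrt (1 + d) - 1.
  have s1 : 1 < Num.sqrt (1 + d).
    by rewrite -{1}(sqrtr1 R) ltr_sqrt; lra.
  have [|n Hn] := la.2 s; first by rewrite /s; lra.
  exists n; rewrite -[leRHS]sqr_sqrtr; last lra.
  by rewrite ler_sqr ?nnegrE ?(nrm_ge0 hB) ?sqrtr_ge0 //; move: Hn; rewrite /s; lra.
pose g := G (n + n)%N; have pg : pos g := pos_defect _.
have p1g : pos (1 - g) := pos_1B_defect _.
have gE : g = G n * G n by rewrite /g /G exprD.
pose w := st a * g * a.
have pw : pos w by exact: pos_conj.
have Nw : N w <= 1 + d.
  have -> : w = st (G n * a) * (G n * a).
    by rewrite (starM hB) /w gE; have [-> _] := pos_defect n; rewrite !mulrA.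
  by rewrite (nrmC hB).
pose y := (1 + d)%:S - w; have py : pos y by apply: (pos_realB hB) => //; case: pw.
have [u [u1 u2 pu yu Nu]] := pos_inv hB e0 py.
pose D := e%:S + y; pose f := y * u; have [su _] := pu; have [sy _] := py.
have sf : st f = f by rewrite /f (starM hB) su sy -yu.
have f1 : 1 - f = e%:c *: u.
  by rewrite -{1}u2 mulrDl real_mull /f addrK.
pose v := st a * (1 - g) * a.
(* [v + w = a* a <= 1 + e] while [D + w = 1 + e + d], so even [D - v >= d]. *)
have pDv : pos (D - v).
  have -> : D - v = (1 + e)%:S - st a * a + d%:S.
    by rewrite /D /y /v /w !realD; ncring.
  apply: (posD hB); last by apply: (pos_real hB); exact: ltW.
  apply: (pos_realB hB); first by rewrite (starM hB) (starK hB).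
  by rewrite (nrmC hB).
have pv : pos v by exact: pos_conj.
have Df : D * f = y.
  by rewrite /f yu mulrA u2 mul1r.
exists (g * a + (1 - g) * (a * f)); split.
- by apply: JD; apply: (Jl) => //; exact: Jr.
- apply: le_trans (N_convex hB _ _ pg p1g) _.
  have -> : st (a * f) * (1 - g) * (a * f) = f * v * f.
    by rewrite (starM hB) sf /v !mulrA.
  rewrite -/w; have pfvf : pos (f * v * f) by exact: pos_conj_sa.
  apply: (pos_N_le hB); [lra | exact: posD | ].
  (* [f v f <= f D f = f y <= y], and [w + y = 1 + d]. *)
  have -> : (1 + d)%:S - (w + f * v * f) = f * (D - v) * f + (y - f * (D * f)).
    by rewrite /y; ncring.
  apply: (posD hB); first exact: pos_conj_sa.
  have -> : y - f * (D * f) = y * (e%:c *: u).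
    by rewrite Df -f1 /f -[y * u * y]mulrA -yu; ncring.
  by rewrite -scalerAr; apply: (posZ hB); [exact: ltW | exact: (posM hB)].
- have -> : g * a + (1 - g) * (a * f) - a = - ((1 - g) * (a * (1 - f))) by ncring.
  rewrite (nrmN hB) f1; set z := a * _.
  apply: le_trans (N_mul_convex hB _ pg p1g) _.
  have sk : st (e%:c *: u) = e%:c *: u by rewrite (starZr hB) su.
  have -> : st z * (1 - g) * z = (e%:c *: u) * v * (e%:c *: u).
    by rewrite /z (starM hB) sk /v !mulrA.
  (* Since [v <= D] and [u D = 1], the bound reduces to [e] times the norm of [e u], which is at
     most 1. *)
  have le1 : N ((e%:c *: u) * v * (e%:c *: u)) <= N ((e%:c *: u) * D * (e%:c *: u)).
    apply: (pos_mono hB); first exact: pos_conj_sa.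
    have -> : (e%:c *: u) * D * (e%:c *: u) - (e%:c *: u) * v * (e%:c *: u) =
        (e%:c *: u) * (D - v) * (e%:c *: u) by ncring.
    exact: pos_conj_sa.
  apply: le_trans le1 _.
  have -> : (e%:c *: u) * D * (e%:c *: u) = e%:c *: (e%:c *: u).
    by rewrite -!scalerAl u1 mul1r.
  rewrite (nrmZr hB) gtr0_norm // -[leRHS]mulr1; apply: ler_wpM2l => //; exact: ltW.
(* The factor [1 - g] is a right multiple of [x], so the coset has not changed. *)
- have -> : g * a + (1 - g) * (a * f) =
      a + x * (- (approx_inv (n + n) * (a * (1 - f)))).
    by rewrite mulrN [x * (_ * _)]mulrA mul_approx_inv -/g; ncring.
  exact: coset_norm1D.
Qed.

End Approximation.

(** * Attaining the coset norm and constructing [k] *)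

Section Lifting.
Variables (R : realType) (B : algType R[i]).
Variables (st : B -> B) (N : B -> R).
Hypothesis hB : is_cstar_algebra *%R st N.
Local Notation pos := (pos st N).
Local Notation "r %:S" := (r%:c *: (1 : B)) (at level 2, format "r %:S").
Variable x : B.
Hypothesis x1 : N x <= 1.
Local Notation G := (defect st x).
Local Notation coset_norm1 := (coset_norm1 st N x).
Variable J : B -> Prop.
Hypothesis hJ : closed_ideal st N J.

Lemma ideal_scale (r : R) a : J a -> J (r%:c *: a).
Proof. by case: hJ => _ H _ _ _ /(H r%:S); rewrite real_mull. Qed.

(** Division by the infimum of the [N (G n * a)], the coset norm of [a]; the lower bound [d] keeps
    it positive. *)
Lemma coset_norm1_exists a (d : R) : J a -> 0 < d -> (forall n, d <= N (G n * a)) ->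
  exists b, J b /\ coset_norm1 b.
Proof.
move=> Ja d0 Ha; pose E := [set s | exists n, s = N (G n * a)]%classic.
have E0 : has_inf E.
  by split; [exists (N (G 0 * a)), 0%N | exists d => _ [n ->]].
have r0 : 0 < inf E.
  by apply: lt_le_trans d0 _; apply: lb_le_inf; [case: E0 | move=> _ [n ->]].
exists ((inf E)^-1%:c *: a); split; first exact: ideal_scale.
have NE n : N (G n * ((inf E)^-1%:c *: a)) = N (G n * a) / inf E.
  by rewrite -scalerAr (nrmZr hB) gtr0_norm ?invr_gt0 // mulrC.
split=> [n|e e0].
  by rewrite NE ler_pdivlMr // mul1r; apply: ge_inf; [case: E0 | exists n].
have [_ [n ->] Hn] := inf_adherent (mulr_gt0 e0 r0) E0.
by exists n; rewrite NE ler_pdivrMr //; lra.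
Qed.

Lemma half_pow_small (e : R) : 0 < e -> exists m : nat, (2^-1 : R) ^+ m < e.
Proof.
move=> e0; have [m Hm] := ex_ltn_real e^-1; exists m.+1.
rewrite exprVn -[ltRHS]invrK ltf_pV2 ?posrE ?invr_gt0 ?exprn_gt0 //.
apply: lt_le_trans Hm _; rewrite -natrX ler_nat.
by apply: ltnW; apply: ltn_expl.
Qed.

(* Successive corrections with errors 4^-k move by at most 2^-k, so they
   converge: the norm modulo the ideal is attained. *)
Lemma norm_attained a : J a -> coset_norm1 a ->
  exists c, [/\ J c, N c <= 1 & 1 <= N ((1 - x * st x) * c)].
Proof.
move=> Ja la; pose p k := (2^-1 : R) ^+ k.
have p0 k : 0 < p k by rewrite /p exprn_gt0 // invr_gt0 ltr0n.
pose P k b := [/\ J b, N b ^+ 2 <= 1 + p k ^+ 2 & coset_norm1 b].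
(* The implication is put under the existential so that [choice] yields a total step function; where
   [P k b] fails, [b] is a dummy value. *)
have step k b : exists b', P k b -> P k.+1 b' /\ N (b' - b) <= p k.
  have [[Jb Nb lb]|nP] := pselect (P k b); last by exists b.
  have [b' [Jb' Nb' d lb']] := coset_norm1_step hB x1 hJ
    (exprn_gt0 2 (p0 k)) (exprn_gt0 2 (p0 k.+1)) Jb Nb lb.
  exists b' => _; split => //; rewrite -ler_sqr ?nnegrE ?(nrm_ge0 hB) //.
  exact: ltW.
have [F HF] := choice (fun kb : nat * B => step kb.1 kb.2).
(* A first correction with error [1 + N a ^+ 2] asks for no prior bound on the norm of [a]; the
   distance it moves is irrelevant. *)
have [b0 P0] : exists b0, P 0%N b0.
  have [b [Jb Nb _ lb]] := coset_norm1_step hB x1 hJ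
    (e := 1 + N a ^+ 2) (d := p 0%N ^+ 2) (ltr_wpDr (sqr_ge0 _) ltr01)
    (exprn_gt0 2 (p0 0%N)) Ja ltac:(lra) la.
  by exists b.
pose u := fix u n := if n is m.+1 then F (m, u m) else b0.
have Pu n : P n (u n) by elim: n => [|n /(HF (n, _))[]].
have ud n : N (u n.+1 - u n) <= p n by have [] := HF (n, u n) (Pu n).
have [c uc] : exists c, cvgs N u c.
  (* [2 - 2 p n] is the sum of the [p i] for [i < n]. *)
  apply: (cvgs_majorant hB (t := fun n => 2 - 2 * p n) (M := 2)) => n.
    have -> : 2 - 2 * p n.+1 - (2 - 2 * p n) = p n by rewrite /p exprS; field.
    exact: ud.
  by have := p0 n; lra.
exists c; split.
- by have [_ _ _ _ H] := hJ; apply: (H _ _ uc) => n; have [] := Pu n.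
- rewrite -subr_le0; apply: (@le0_of_small _ _ 1) => e e0; rewrite mul1r.
  have [m Hm] := half_pow_small e0; rewrite lerBlDl.
  have shift : cvgs N (fun n => u (n + m)%N) c.
    move=> d /uc[K HK]; exists K => n Kn; apply: HK; exact: leq_trans (leq_addr _ _).
  apply: (cvgs_nrm_le hB shift) => n; have [_ Hn _] := Pu (n + m)%N.
  have pm : p (n + m)%N <= p m.
    rewrite /p exprD -[leRHS]mul1r; apply: ler_wpM2r; first exact/ltW/p0.
    apply: exprn_ile1; lra.
  have : N (u (n + m)%N) <= 1 + p (n + m)%N.
    have pn := p0 (n + m)%N; rewrite -ler_sqr ?nnegrE ?(nrm_ge0 hB) //; last lra.
    by move: Hn; rewrite sqrrD; lra.
  by move: Hm; rewrite -/(p m); lra.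
- have Hc := cvgs_mull hB (1 - x * st x) uc.
  rewrite -subr_le0; apply: (@le0_of_small _ _ 1) => e /Hc[K /(_ K (leqnn _))].
  have [_ _ [/(_ 1%N) + _]] := Pu K; rewrite /defect expr1 mul1r.
  have := nrmD hB ((1 - x * st x) * u K - (1 - x * st x) * c) ((1 - x * st x) * c).
  by rewrite subrK; lra.
Qed.

Lemma exposing_element a (d : R) : J a -> 0 < d -> (forall n, d <= N (G n * a)) ->
  exists k, [/\ J k, pos k, N k = 1 & pos (1 - (k + x * st x))].
Proof.
move=> Ja d0 /(coset_norm1_exists Ja d0)[b [Jb /(norm_attained Jb)[c [Jc c1 lc]]]].
pose h := x * st x; have p1h : pos (1 - h) := pos_1Bh hB x1.
have ph : pos h := pos_h hB x.
have [s1h _] := p1h.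
pose X := (1 - h) * c; exists (X * st X).
have NX : N X = 1.
  apply/eqP; rewrite eq_le lc andbT; apply: le_trans (nrmM hB _ _) _.
  rewrite -[leRHS]mulr1; apply: ler_pM; rewrite ?(nrm_ge0 hB) //.
  by apply: (pos_N_le1 hB) => //; rewrite subKr.
have [_ Jl Jr Js _] := hJ.
split.
- by apply: Jr; exact: Jl.
- exact: pos_mul_star.
- by rewrite (nrmC' hB) NX expr1n.
(* Splitting [1 - h = (1 - h)^2 + (1 - h) h] lets [k = (1 - h) c c* (1 - h)] be subtracted from the
   first term, where [c c* <= 1]. *)
- have -> : 1 - (X * st X + h) = (1 - h) * (1 - c * st c) * (1 - h) + (1 - h) * h.
    by rewrite /X (starM hB) s1h; ncring.
  apply: (posD hB); last by apply: (posM hB) => //; ncring.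
  apply: pos_conj_sa => //; apply: (pos_1B hB).
    by rewrite (starM hB) (starK hB).
  by rewrite (nrmC' hB) expr_le1 // (nrm_ge0 hB).
Qed.

End Lifting.

(** * Real functionals bounded by the norm on [J] and peaking at [k] *)

Section ExposedFunctional.
Variables (R : realType) (B : algType R[i]).
Variables (st : B -> B) (N : B -> R).
Hypothesis hB : is_cstar_algebra *%R st N.
Local Notation pos := (pos st N).
Local Notation "r %:S" := (r%:c *: (1 : B)) (at level 2, format "r %:S").
Variable J : B -> Prop.
Hypothesis hJ : closed_ideal st N J.
Variables (phi : B -> R) (k : B).
Hypothesis phiD : forall a b, phi (a + b) = phi a + phi b.
Hypothesis phiZ : forall (r : R) a, phi (r%:c *: a) = r * phi a.
Hypothesis phi_le : forall a, J a -> phi a <= N a.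
Hypotheses (Jk : J k) (pk : pos k) (p1k : pos (1 - k)) (phik : phi k = 1).

Lemma exposedN a : phi (- a) = - phi a.
Proof. by rewrite -scaleN1r -[X in X *: _](rmorphN1 (real_complex R)) phiZ mulN1r. Qed.

(** If [s > 0], the left side grows like [1 + 2 t s] near [t = 0] and the right side only
    quadratically; [t = s / (1 + m)] is small enough to show it. The second alternative covers the
    case where squaring is not monotone. *)
Lemma le_sqrt_quad (s m : R) : 0 <= m ->
  (forall t, 0 < t -> (1 + t * s) ^+ 2 <= 1 + t ^+ 2 * m \/ 1 + t * s <= 0) -> s <= 0.
Proof.
move=> m0 H; rewrite leNgt; apply/negP => s0.
have t0 : 0 < s / (1 + m) by rewrite divr_gt0 //; lra.
have [] := H _ t0; last by have := mulr_gt0 t0 s0; lra.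
set t := _ / _; have ts : t * (1 + m) = s by rewrite /t mulfVK //; lra.
have := mulr_gt0 t0 s0; rewrite -/t => ts0; nra.
Qed.

(** A functional bounded by the norm and peaking at [c] cannot increase in a direction along which
    the norm grows only to second order. Used with [w] and [- w], this gives the vanishing results
    below. *)
Lemma exposed_le0 c w (m : R) : J c -> J w -> phi c = 1 -> 0 <= m ->
  (forall t : R, 0 < t -> N (c + t%:c *: w) ^+ 2 <= 1 + t ^+ 2 * m) -> phi w <= 0.
Proof.
move=> Jc Jw c1 m0 H; apply: (le_sqrt_quad m0) => t t0.
have [JD _ _ _ _] := hJ.
have : 1 + t * phi w <= N (c + t%:c *: w).
  rewrite -c1 -phiZ -phiD; apply: phi_le; apply: JD => //.
  exact: (ideal_scale hJ).
have [lt0|gt0] := lerP (1 + t * phi w) 0; first by right.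
move=> le; left; apply: le_trans (H _ t0).
by rewrite ler_sqr ?nnegrE ?(nrm_ge0 hB) // ltW.
Qed.

Lemma idealN a : J a -> J (- a).
Proof. by rewrite -[- a]mulN1r; case: hJ => _ H _ _ _; exact: H. Qed.

(** [k + t (1 - k) z] is the convex combination of [1] and [t z] with weights [k] and [1 - k], so
    [N_convex] bounds its squared norm by [1 + O(t^2)]. The other side follows by taking
    adjoints. *)
Lemma exposed_mul1B w : J w -> phi ((1 - k) * w) = 0 /\ phi (w * (1 - k)) = 0.
Proof.
have [_ Jl Jr Js _] := hJ.
have bound z (t : R) : 0 < t ->
    N (k + t%:c *: ((1 - k) * z)) ^+ 2 <= 1 + t ^+ 2 * N (st z * (1 - k) * z).
  move=> t0; have := N_convex hB 1 (t%:c *: z) pk p1k.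
  rewrite (st1 hB) mul1r !mulr1 -scalerAr => /le_trans; apply.
  apply: le_trans (nrmD hB _ _) _; apply: lerD; first exact: (pos_N_le1 hB).
  rewrite (starZr hB) -!scalerAl -scalerAr scalerA -realC_M (nrmZr hB).
  by rewrite ger0_norm ?mulr_ge0 ?(ltW t0) // expr2.
have L z : J z -> phi ((1 - k) * z) <= 0.
  move=> Jz; apply: (exposed_le0 Jk _ phik (nrm_ge0 hB _) (bound z)).
  exact: Jl.
have Rr z : J z -> phi (z * (1 - k)) <= 0.
  move=> Jz; apply: (exposed_le0 Jk _ phik (nrm_ge0 hB (st (st z) * (1 - k) * st z))).
    exact: Jr.
  move=> t t0; apply: le_trans _ (bound (st z) t t0).
  have [sk _] := pk; have [s1k _] := p1k.
  by rewrite -(nrm_star hB) (starD hB) (starZr hB) (starM hB) sk s1k.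
move=> Jw; have Jn := idealN Jw; split; apply/eqP; rewrite eq_le.
  rewrite L //= -oppr_le0 -exposedN -mulrN; exact: L.
by rewrite Rr //= -oppr_le0 -exposedN -mulNr; exact: Rr.
Qed.

(** Compression by [k] brings elements involving the unit into [J], the only place where [phi] is
    controlled, without changing [phi] on [J]. *)
Lemma exposed_sandwich w : J w -> phi (k * w * k) = phi w.
Proof.
have [_ Jl _ _ _] := hJ; move=> Jw; have [H _] := exposed_mul1B Jw.
have [_ H'] := exposed_mul1B (Jl k _ Jw).
have -> : k * w * k = w - (1 - k) * w - k * w * (1 - k) by ncring.
by rewrite !phiD !exposedN H H' !subr0.
Qed.

Lemma exposed_kk : phi (k * k) = 1.
Proof.
have [H _] := exposed_mul1B Jk.
have -> : k * k = k - (1 - k) * k by ncring.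
by rewrite phiD exposedN H phik subr0.
Qed.

Lemma N_conj_k a : N (k * a * k) <= N a.
Proof.
have Nk : N k <= 1 by exact: (pos_N_le1 hB).
have H b : N (k * b) <= N b.
  apply: le_trans (nrmM hB _ _) _; rewrite -[leRHS]mul1r.
  by apply: ler_wpM2r => //; exact: nrm_ge0 hB _.
apply: le_trans (nrmM hB _ _) _; rewrite -[leRHS]mulr1.
by apply: ler_pM; rewrite ?(nrm_ge0 hB).
Qed.

(** The classical argument [N w - phi w <= N (N w - w) <= N w], compressed by [k] so that [k k]
    plays the part of the unit. *)
Lemma exposed_pos w : J w -> pos w -> 0 <= phi w.
Proof.
move=> Jw pw; have [sw _] := pw; have [_ Jl Jr _ _] := hJ.
have N0 := nrm_ge0 hB w.
have Nle : N (k * ((N w)%:S - w) * k) <= N w.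
  apply: le_trans (N_conj_k _) _; apply: (pos_N_le hB) => //.
    exact: (pos_realB hB).
  by rewrite subKr.
have := le_trans (phi_le (Jr _ _ (Jr _ _ Jk))) Nle.
have -> : k * ((N w)%:S - w) * k = (N w)%:c *: (k * k) - k * w * k.
  by rewrite mulrBr mulrBl real_comm real_mull -scalerAl.
by rewrite phiD phiZ exposedN exposed_kk exposed_sandwich // mulr1; lra.
Qed.

(** This makes the complexification of [phi] real on self-adjoint elements. For self-adjoint [z] the
    squared norm of [1 + i t z] is that of [1 + t^2 z^2], a second-order growth that survives
    compression by [k]. *)
Lemma exposed_i_sa w : J w -> st w = w -> phi ('i%C *: w) = 0.
Proof.
have [_ Jl Jr Js _] := hJ.
have L z : J z -> st z = z -> phi ('i%C *: z) <= 0.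
  move=> Jz sz; have Jiz : J ('i%C *: z).
    by rewrite -[z]mul1r scalerAl; exact: Jl.
  rewrite -exposed_sandwich //.
  apply: (exposed_le0 (Jl k _ Jk) _ exposed_kk (sqr_ge0 (N z))).
    by apply: (Jr); exact: Jl.
  move=> t t0; pose v := t%:c *: ('i%C *: z).
  have sv : st v = - v.
    rewrite /v (starZr hB) (starZ hB) sz -scalerN -scaleNr; congr (_ *: (_ *: _)).
    by apply/eqP; rewrite eq_complex /= oppr0 !eqxx.
  have vv : v * v = - (t ^+ 2)%:c *: (z * z).
    rewrite /v -!scalerAl -!scalerAr !scalerA; congr (_ *: _).
    by apply/eqP; rewrite eq_complex /=; apply/andP; split; apply/eqP; ring.
  have -> : k * k + t%:c *: (k * ('i%C *: z) * k) = k * (1 + v) * k.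
    by rewrite /v mulrDr mulrDl mulr1 -!scalerAr -!scalerAl.
  apply: le_trans (_ : N (1 + v) ^+ 2 <= _).
    by rewrite ler_sqr ?nnegrE ?(nrm_ge0 hB) // N_conj_k.
  rewrite -(nrmC hB) (starD hB) (st1 hB) sv.
  have -> : (1 - v) * (1 + v) = 1 - v * v by ncring.
  rewrite vv scaleNr opprK; apply: le_trans (nrmD hB _ _) _.
  by rewrite (N1 hB) (nrmZr hB) (N_sa hB sz) ger0_norm ?sqr_ge0.
move=> Jw sw; apply/eqP; rewrite eq_le L //= -oppr_le0 -exposedN -scalerN.
by apply: L; [exact: idealN | rewrite (starN hB) sw].
Qed.

(** [1 + phi h = phi (k + h) <= N (k + h) <= 1], and [phi h >= 0]. *)
Lemma exposed_zero h : J h -> pos h -> pos (1 - (k + h)) -> phi h = 0.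
Proof.
move=> Jh ph p1; apply/eqP; rewrite eq_le exposed_pos // andbT.
have [JD _ _ _ _] := hJ.
have := phi_le (JD _ _ Jk Jh); rewrite phiD phik.
have := pos_N_le1 hB (posD hB pk ph) p1; lra.
Qed.

End ExposedFunctional.

(** * Extreme functionals *)

Section ExtremeFunctional.
Variables (R : realType) (V : lmodType R[i]).

Definition sublinear (q : V -> R) : Prop :=
  (forall a b, q (a + b) <= q a + q b) /\
  (forall (r : R) a, 0 < r -> q (r%:c *: a) = r * q a).

Definition real_linear (f : V -> R) : Prop :=
  (forall a b, f (a + b) = f a + f b) /\ (forall (r : R) a, f (r%:c *: a) = r * f a).

Definition dominated (f q : V -> R) : Prop := forall a, f a <= q a.

Lemma scale_real1 (a : V) : (1 : R)%:c *: a = a. Proof. exact: scale1r. Qed.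
Lemma scale_real0 (a : V) : (0 : R)%:c *: a = 0. Proof. exact: scale0r. Qed.

Lemma sublinear0 q : sublinear q -> q 0 = 0.
Proof. by move=> [_ H]; have := H 2 0 (ltr0n _ 2); rewrite scaler0; lra. Qed.

Lemma sublinear_geN q a : sublinear q -> - q (- a) <= q a.
Proof.
move=> sq; have [qD _] := sq; have := qD a (- a).
by rewrite subrr sublinear0 //; lra.
Qed.

Lemma real_linearN f a : real_linear f -> f (- a) = - f a.
Proof.
by move=> [_ fZ]; rewrite -scaleN1r -[X in X *: _](rmorphN1 (real_complex R)) fZ mulN1r.
Qed.

Lemma real_linear_le_eq f g : real_linear f -> real_linear g -> dominated f g ->
  forall a, f a = g a.
Proof.
move=> lf lg fg a; apply/eqP; rewrite eq_le fg /=.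
by have := fg (- a); rewrite !real_linearN // lerN2.
Qed.

Variable q0 : V -> R.
Hypothesis sq0 : sublinear q0.

(** The real-linear functionals below [q] form an extreme subset of those below [q0]. Sublinear
    functionals thus encode faces, with no topology on the dual. *)
Definition face (q : V -> R) : Prop := forall (f g : V -> R) (t : R),
  0 < t -> t < 1 -> real_linear f -> real_linear g -> dominated f q0 -> dominated g q0 ->
  (forall a, t * f a + (1 - t) * g a <= q a) -> dominated f q /\ dominated g q.

(* The support functional of the face [f b = q b] of the set [f <= q]. *)
Definition exposed_set (q : V -> R) (b a : V) : set R :=
  [set s | exists2 t : R, 0 <= t & s = q (a + t%:c *: b) - t * q b]%classic.
Definition expose (q : V -> R) (b a : V) : R := inf (exposed_set q b a).

Section Expose.
Variables (q : V -> R) (b : V).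
Hypothesis sq : sublinear q.

Lemma sublinear_ge0Z (t : R) : 0 <= t -> q (t%:c *: b) = t * q b.
Proof.
rewrite le_eqVlt => /orP[/eqP <-|t0]; last by have [_ H] := sq; exact: H.
by rewrite mul0r scale_real0 sublinear0.
Qed.

Lemma exposed_set_inf a : has_inf (exposed_set q b a).
Proof.
split; first by exists (q (a + 0%:c *: b) - 0 * q b), 0.
exists (- q (- a)) => _ [t t0 ->]; have [qD _] := sq.
have := qD (a + t%:c *: b) (- a).
by rewrite addrAC subrr add0r sublinear_ge0Z //; lra.
Qed.

Lemma expose_le_at (t : R) a : 0 <= t -> expose q b a <= q (a + t%:c *: b) - t * q b.
Proof. by move=> t0; apply: ge_inf; [case: (exposed_set_inf a) | exists t]. Qed.

Lemma expose_le : dominated (expose q b) q.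
Proof.
move=> a; have := @expose_le_at 0 a (lexx _); rewrite mul0r subr0.
by rewrite scale_real0 addr0.
Qed.

(** Consequently every linear [f] below [expose q b] satisfies [f b >= q b], that is, lies in the
    face where [f b = q b]. *)
Lemma exposeN : expose q b (- b) <= - q b.
Proof.
have := @expose_le_at 1 (- b) ler01; rewrite mul1r.
by rewrite scale_real1 addNr sublinear0 // sub0r.
Qed.

Lemma expose_ge (m : R) a :
  (forall t : R, 0 <= t -> m <= q (a + t%:c *: b) - t * q b) -> m <= expose q b a.
Proof.
move=> H; apply: lb_le_inf; first by case: (exposed_set_inf a).
by move=> _ [t t0 ->]; exact: H.
Qed.

Lemma expose_sublinear : sublinear (expose q b).
Proof.
have [qD qZ] := sq; split=> [a c|r a r0].
  rewrite -subr_le0; apply: (@le0_of_small _ _ 1) => e e0; rewrite mul1r.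
  have e2 : 0 < e / 2 by lra.
  have [_ [t t0 ->] Ht] := inf_adherent e2 (exposed_set_inf a).
  have [_ [s s0 ->] Hs] := inf_adherent e2 (exposed_set_inf c).
  have := @expose_le_at (t + s) (a + c) (addr_ge0 t0 s0).
  have := qD (a + t%:c *: b) (c + s%:c *: b).
  rewrite addrACA -scalerDl -realC_D; move: Ht Hs; rewrite -!/(expose _ _ _); lra.
have half u c : 0 < u -> expose q b (u%:c *: c) <= u * expose q b c.
  move=> u0; rewrite -ler_pdivrMl //; apply: expose_ge => t t0.
  rewrite ler_pdivrMl //.
  have := @expose_le_at (u * t) (u%:c *: c) (mulr_ge0 (ltW u0) t0).
  by rewrite realC_M -scalerA -scalerDr qZ //; lra.
apply/eqP; rewrite eq_le half //= -ler_pdivlMl //.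
have := half r^-1 (r%:c *: a); rewrite invr_gt0 => /(_ r0).
by rewrite scalerA -realC_M mulVf ?gt_eqF // scale_real1.
Qed.

Lemma expose_face : face q -> dominated q q0 -> face (expose q b).
Proof.
move=> fq _ f g t t0 t1 lf lg f0 g0 H.
have [fq' gq'] := fq f g t t0 t1 lf lg f0 g0 (fun a => le_trans (H a) (expose_le a)).
have [fZ gZ] := (lf.2, lg.2); have [fD gD] := (lf.1, lg.1).
(* The convex combination reaches the maximal value at [b], so both [f] and [g] do; evaluating them
   at [a + s b] then gives the bounds defining [expose]. *)
have Hb : q b <= t * f b + (1 - t) * g b.
  have := le_trans (H (- b)) exposeN; rewrite !real_linearN //; lra.
have fb : f b = q b by have := fq' b; have := gq' b; nra.
have gb : g b = q b by have := fq' b; have := gq' b; nra.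
split=> a; apply: expose_ge => s s0.
  by have := fq' (a + s%:c *: b); rewrite fD fZ fb; lra.
by have := gq' (a + s%:c *: b); rewrite gD gZ gb; lra.
Qed.

End Expose.

(* Minimal elements among the sublinear functionals supporting a face are
   linear: this is Hahn-Banach and Krein-Milman at once. *)
Lemma extreme_functional (k : V) : exists f, [/\ real_linear f, dominated f q0,
  f k = q0 k & forall (f1 f2 : V -> R) (t : R), 0 < t -> t < 1 ->
    real_linear f1 -> real_linear f2 -> dominated f1 q0 -> dominated f2 q0 ->
    (forall a, f a = t * f1 a + (1 - t) * f2 a) ->
    forall a, f1 a = f a /\ f2 a = f a].
Proof.
pose q1 := expose q0 k.
pose ok q := [/\ sublinear q, face q & dominated q q1].
have q10 : dominated q1 q0 := expose_le k sq0.
have ok1 : ok q1.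
  split=> //; first exact: expose_sublinear.
  by apply: expose_face => // f g t *; split.
(* The order is reversed: a maximal element for [le] is a minimal sublinear functional. Starting
   from [expose q0 k] forces the value at [k]. *)
pose T := {q | ok q}; pose le (p q : T) := `[< dominated (sval q) (sval p) >].
have [|||[q okq] qmin] := @ZL_preorder T (exist _ q1 ok1) le.
- by move=> p; apply/asboolP => a.
- by move=> p q r /asboolP pq /asboolP qr; apply/asboolP => a; exact: le_trans (qr a) (pq a).
- move=> C totC; have [[p0 Cp0]|C0] := pselect (exists p, C p); last first.
    by exists (exist _ q1 ok1) => s Cs; case: C0; exists s.
  pose E a := [set s | exists2 p, C p & s = sval p a]%classic.
  have hE a : has_inf (E a).
    split; first by exists (sval p0 a), p0.
    exists (- q0 (- a)) => _ [p _ ->]; case: p => p [sp _ p1] /=.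
    apply: le_trans (sublinear_geN a sp); rewrite lerN2.
    exact: le_trans (p1 _) (q10 _).
  pose m a := inf (E a).
  have mle p a : C p -> m a <= sval p a.
    by move=> Cp; apply: ge_inf; [case: (hE a) | exists p].
  have mge (s : R) a : (forall p, C p -> s <= sval p a) -> s <= m a.
    move=> H; apply: lb_le_inf; first by case: (hE a).
    by move=> _ [p Cp ->]; exact: H.
  have okm : ok m.
    split; first split=> [a b|r a r0].
    + rewrite -subr_le0; apply: (@le0_of_small _ _ 1) => e e0; rewrite mul1r.
      have e2 : 0 < e / 2 by lra.
      have [_ [p Cp ->] Hp] := inf_adherent e2 (hE a).
      have [_ [p' Cp' ->] Hp'] := inf_adherent e2 (hE b).
      (* Subadditivity of the infimum needs one member of the chain good for both points: the
         smaller of the two. *)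
      have [r [Cr rp rp']] : exists r, [/\ C r, sval r a <= sval p a & sval r b <= sval p' b].
        have [/asboolP pp|/asboolP pp] := totC _ _ Cp Cp'.
          by exists p'; split.
        by exists p; split.
      have := mle _ (a + b) Cr; have [[rD _] _ _] := svalP r.
      have := rD a b; move: Hp Hp'; rewrite -!/(m _); lra.
    + have half u c : 0 < u -> m (u%:c *: c) <= u * m c.
        move=> u0; rewrite -ler_pdivrMl //; apply: mge => p Cp.
        rewrite ler_pdivrMl //; apply: le_trans (mle _ _ Cp) _.
        by have [[_ pZ] _ _] := svalP p; rewrite pZ.
      apply/eqP; rewrite eq_le half //= -ler_pdivlMl //.
      have := half r^-1 (r%:c *: a); rewrite invr_gt0 => /(_ r0).
      by rewrite scalerA -realC_M mulVf ?gt_eqF // scale_real1.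
    + move=> f g t t0 t1 lf lg f0 g0 H.
      have {}H p : C p -> dominated f (sval p) /\ dominated g (sval p).
        move=> Cp; have [_ fp _] := svalP p; apply: (fp f g t) => // a.
        exact: le_trans (H a) (mle _ _ Cp).
      by split=> a; apply: mge => p /H[fp gp]; [exact: fp | exact: gp].
    + by move=> a; apply: le_trans (mle _ a Cp0) _; have [_ _ H] := svalP p0; exact: H.
  by exists (exist _ m okm) => p Cp; apply/asboolP => a; exact: mle.
have [sq fq qq1] := okq.
have qq0 a : q a <= q0 a := le_trans (qq1 a) (q10 a).
(* By minimality [q] equals its own exposure at [b], so [exposeN] makes it odd; an odd sublinear
   functional is linear. *)
have qN b : q (- b) = - q b.
  have okb : ok (expose q b).
    split; [exact: expose_sublinear | exact: expose_face |].
    by move=> a; exact: le_trans (expose_le b sq a) (qq1 a).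
  have /asboolP/= qle := qmin (exist _ _ okb) (asboolT (expose_le b sq)).
  apply/eqP; rewrite eq_le; apply/andP; split.
    exact: le_trans (qle _) (exposeN b sq).
  by have := sublinear_geN b sq; lra.
have [qD qZ] := sq.
have lq : real_linear q.
  split=> [a b|r a].
    apply/eqP; rewrite eq_le qD /=.
    by have := qD (- a) (- b); rewrite -opprD !qN; lra.
  have [r0|r0] := lerP 0 r; first exact: sublinear_ge0Z.
  rewrite -[r]opprK rmorphN scaleNr qN qZ ?oppr_gt0 //; ring.
exists q; split => //.
  apply/eqP; rewrite eq_le qq0 /=.
  have := le_trans (qq1 (- k)) (exposeN k sq0); rewrite qN; lra.
move=> f1 f2 t t0 t1 l1 l2 d1 d2 E.
have [a|H1 H2 a] := fq f1 f2 t t0 t1 l1 l2 d1 d2; first by rewrite E.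
by split; exact: real_linear_le_eq.
Qed.

End ExtremeFunctional.

(** * The unitization *)

(** The limit is found as the supremum of the eventual lower bounds, the lower limit of the
    sequence. *)
Lemma real_cauchy (R : realType) (u : nat -> R) :
  (forall e : R, 0 < e -> exists K : nat, forall m n : nat,
     (K <= m)%N -> (K <= n)%N -> `|u m - u n| < e) ->
  exists l, forall e : R, 0 < e -> exists K : nat, forall n, (K <= n)%N -> `|u n - l| < e.
Proof.
move=> Hu; pose E := [set s | exists K : nat, forall n, (K <= n)%N -> s <= u n]%classic.
have near e : 0 < e -> exists K : nat, forall n, (K <= n)%N -> u K - e < u n < u K + e.
  move=> /Hu[K HK]; exists K => n Kn; have := HK n K Kn (leqnn K).
  by rewrite ltr_norml => /andP[]; lra.
have E_ub K e s : (forall n, (K <= n)%N -> u K - e < u n < u K + e) -> E s -> s <= u K + e.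
  move=> HK [L HL]; have := HL _ (leq_maxr K L).
  by have /andP[_] := HK _ (leq_maxl K L); lra.
have hE : has_sup E.
  have [K HK] := near 1 ltr01; split; last by exists (u K + 1) => s; exact: E_ub.
  by exists (u K - 1), K => n /HK/andP[+ _]; exact: ltW.
exists (sup E) => e e0; have e2 : 0 < e / 2 by lra.
have [K HK] := near _ e2; exists K => n Kn.
have lo : u K - e / 2 <= sup E.
  by apply: sup_upper_bound => //; exists K => m /HK/andP[+ _]; exact: ltW.
have hi : sup E <= u K + e / 2.
  by apply: ge_sup; [case: hE | move=> s; exact: E_ub].
by rewrite ltr_norml; have /andP[] := HK n Kn; lra.
Qed.

Lemma normc_ge_ReIm (R : realType) (z : R[i]) : 
  `|complex.Re z| <= Normc.normc z /\ `|complex.Im z| <= Normc.normc z.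
Proof.
case: z => a b /=; rewrite -!sqrtr_sqr; split; rewrite ler_sqrt ?addr_ge0 ?sqr_ge0 //.
  by rewrite lerDl sqr_ge0.
by rewrite lerDr sqr_ge0.
Qed.

Lemma normc_le_ReIm (R : realType) (z : R[i]) :
  Normc.normc z <= `|complex.Re z| + `|complex.Im z|.
Proof.
case: z => a b /=; have a0 := normr_ge0 a; have b0 := normr_ge0 b.
rewrite -[leRHS]ger0_norm ?addr_ge0 // -sqrtr_sqr ler_sqrt ?sqr_ge0 //.
rewrite sqrrD -(real_normK (num_real a)) -(real_normK (num_real b)).
by rewrite addrAC lerDl mulrn_wge0 // mulr_ge0.
Qed.

Lemma complex_cauchy (R : realType) (u : nat -> R[i]) :
  (forall e : R, 0 < e -> exists K : nat, forall m n : nat,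
     (K <= m)%N -> (K <= n)%N -> Normc.normc (u m - u n) < e) ->
  exists l, forall e : R, 0 < e -> exists K : nat, forall n, (K <= n)%N ->
     Normc.normc (u n - l) < e.
Proof.
move=> Hu.
have ReB (z w : R[i]) : complex.Re (z - w) = complex.Re z - complex.Re w
  by case: z; case: w.
have ImB (z w : R[i]) : complex.Im (z - w) = complex.Im z - complex.Im w
  by case: z; case: w.
have [a Ha] : exists a, forall e : R, 0 < e ->
    exists K : nat, forall n, (K <= n)%N -> `|complex.Re (u n) - a| < e.
  apply: real_cauchy => e /Hu[K HK]; exists K => m n Km Kn.
  by rewrite -ReB; apply: le_lt_trans (HK m n Km Kn); have [] := normc_ge_ReIm (u m - u n).
have [b Hb] : exists b, forall e : R, 0 < e ->
    exists K : nat, forall n, (K <= n)%N -> `|complex.Im (u n) - b| < e.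
  apply: real_cauchy => e /Hu[K HK]; exists K => m n Km Kn.
  by rewrite -ImB; apply: le_lt_trans (HK m n Km Kn); have [] := normc_ge_ReIm (u m - u n).
exists (Complex a b) => e e0; have e2 : 0 < e / 2 by lra.
have [K HK] := Ha _ e2; have [L HL] := Hb _ e2; exists (maxn K L) => n.
rewrite geq_max => /andP[/HK Hn /HL Hn']; apply: le_lt_trans (normc_le_ReIm _) _.
by rewrite ReB ImB /=; lra.
Qed.

Lemma normc_nneg (R : realType) (z : R[i]) : 0 <= Normc.normc z.
Proof. by case: z => a b; exact: sqrtr_ge0. Qed.

(** The proof [hA] is a parameter of the type because the ring structure put on it draws its laws
    from [hA]. *)
Definition unitization (R : realType) (A : lmodType R[i]) (mul : A -> A -> A)
  (star : A -> A) (nrm : A -> R) (hA : is_cstar_algebra mul star nrm) : Type :=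
  (R[i]^o * A)%type.

Section Unitization.
Variables (R : realType) (A : lmodType R[i]).
Variables (mul : A -> A -> A) (star : A -> A) (nrm : A -> R).
Hypothesis hA : is_cstar_algebra mul star nrm.
Local Notation U := (unitization hA).

HB.instance Definition _ := GRing.Lmodule.copy U (R[i]^o * A)%type.

Definition umul (p q : U) : U :=
  (p.1 * q.1, p.1 *: q.2 + q.1 *: p.2 + mul p.2 q.2).
Definition uone : U := (1, 0).

Fact umulA : associative umul.
Proof.
move=> [a x] [b y] [c z]; congr (_, _) => /=; first exact: mulrA.
rewrite !(cmulDl hA) !(cmulDr hA) !(cmulZl hA) !(cmulZr hA) (cmulA hA) !scalerDr !scalerA.
rewrite [c * a]mulrC [c * b]mulrC !addrA.
by rewrite [LHS](ACl (1*2*4*6*3*5*7))%AC.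
Qed.
Fact umul1l : left_id uone umul.
Proof.
move=> [b y]; congr (_, _) => /=; first exact: mul1r.
by rewrite scale1r scaler0 addr0 -[X in mul X _](scale0r (0 : A)) (cmulZl hA) scale0r addr0.
Qed.
Fact umul1r : right_id uone umul.
Proof.
move=> [b y]; congr (_, _) => /=; first exact: mulr1.
by rewrite scale1r scaler0 add0r (cmul0 hA) addr0.
Qed.
Fact umulDl : left_distributive umul +%R.
Proof.
move=> [a x] [b y] [c z]; congr (_, _) => /=; first exact: mulrDl.
rewrite (cmulDl hA) scalerDl scalerDr; set s1 := a *: z.
by rewrite !addrA [LHS](ACl (1*3*5*2*4*6))%AC.
Qed.
Fact umulDr : right_distributive umul +%R.
Proof.
move=> [a x] [b y] [c z]; congr (_, _) => /=; first exact: mulrDr.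
rewrite (cmulDr hA) scalerDl scalerDr.
by rewrite !addrA [LHS](ACl (1*3*5*2*4*6))%AC.
Qed.
Fact uone_neq0 : uone != 0.
Proof. by apply/eqP => -[/eqP]; rewrite oner_eq0. Qed.

HB.instance Definition _ := GRing.Zmodule_isNzRing.Build U
  umulA umul1l umul1r umulDl umulDr uone_neq0.

Fact uscaleAl (k : R[i]) (p q : U) : k *: (p * q) = (k *: p) * q.
Proof.
case: p q => [a x] [b y]; congr (_, _) => /=; first exact: scalerAl.
by rewrite !scalerDr (cmulZl hA) !scalerA (mulrC k b).
Qed.
HB.instance Definition _ := GRing.Lmodule_isLalgebra.Build R[i] U uscaleAl.

Fact uscaleAr (k : R[i]) (p q : U) : k *: (p * q) = p * (k *: q).
Proof.
case: p q => [a x] [b y]; congr (_, _) => /=; first exact: scalerAr.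
by rewrite !scalerDr (cmulZr hA) !scalerA (mulrC k a).
Qed.
HB.instance Definition _ := GRing.Lalgebra_isAlgebra.Build R[i] U uscaleAr.

End Unitization.

Section UnitizationNorm.
Variables (R : realType) (A : lmodType R[i]).
Variables (mul : A -> A -> A) (star : A -> A) (nrm : A -> R).
Hypothesis hA : is_cstar_algebra mul star nrm.
Hypothesis hnu : non_unital mul.
Local Notation U := (unitization hA).

Definition ustar (p : U) : U := (conjc p.1, star p.2).
Definition uact (p : U) (y : A) : A := p.1 *: y + mul p.2 y.
Definition unorm_set (p : U) : set R :=
  [set s | exists2 y, nrm y <= 1 & s = nrm (uact p y)]%classic.
Definition unorm (p : U) : R := sup (unorm_set p).
Definition uinj (a : A) : U := (0, a).

Lemma uactD p q y : uact (p + q) y = uact p y + uact q y.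
Proof. by rewrite /uact /= scalerDl (cmulDl hA) addrACA. Qed.
Lemma uactZ k p y : uact (k *: p) y = k *: uact p y.
Proof. by rewrite /uact /= (cmulZl hA) scalerDr scalerA. Qed.
Lemma uactM p q y : uact (p * q) y = uact p (uact q y).
Proof.
case: p q => [a v] [b w]; rewrite /uact /= !(cmulDl hA) !(cmulDr hA).
by rewrite !(cmulZl hA) (cmulZr hA) (cmulA hA) !scalerDr !scalerA !addrA.
Qed.
Lemma uact_scale p k y : uact p (k *: y) = k *: uact p y.
Proof. by rewrite /uact (cmulZr hA) scalerDr !scalerA mulrC. Qed.
Lemma uact_inj a y : uact (uinj a) y = mul a y.
Proof. by rewrite /uact /= scale0r add0r. Qed.
Lemma star_uact p y z : mul (star (uact p y)) z = mul (star y) (uact (ustar p) z).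
Proof.
rewrite /uact /= (starD hA) (starZ hA) (starM hA) (cmulDl hA) (cmulZl hA).
by rewrite (cmulDr hA) (cmulZr hA) (cmulA hA).
Qed.

Lemma unorm_sup p : has_sup (unorm_set p).
Proof.
split; first by exists (nrm (uact p 0)), 0; rewrite // (nrm0 hA) ler01.
exists (Normc.normc p.1 + nrm p.2) => _ [y y1 ->].
apply: le_trans (nrmD hA _ _) _; rewrite (nrmZ hA); apply: lerD.
  by rewrite -[leRHS]mulr1; apply: ler_wpM2l => //; exact: normc_nneg.
apply: le_trans (nrmM hA _ _) _; rewrite -[leRHS]mulr1.
by apply: ler_wpM2l => //; exact: nrm_ge0 hA _.
Qed.

Lemma unorm_ge0 p : 0 <= unorm p.
Proof.
apply: le_trans (_ : nrm (uact p 0) <= _); first exact: nrm_ge0 hA _.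
apply: sup_upper_bound; first exact: unorm_sup.
by exists 0; rewrite // (nrm0 hA) ler01.
Qed.

Lemma uact_le p y : nrm (uact p y) <= unorm p * nrm y.
Proof.
have [->|/eqP/(nrm_gt0 hA) y0] := eqVneq y 0.
  by rewrite /uact scaler0 (cmul0 hA) addr0 (nrm0 hA) mulr0.
rewrite -ler_pdivrMr // mulrC -[X in X * _]gtr0_norm ?invr_gt0 // -(nrmZr hA) -uact_scale.
apply: sup_upper_bound; first exact: unorm_sup.
exists ((nrm y)^-1%:c *: y) => //.
by rewrite (nrmZr hA) gtr0_norm ?invr_gt0 // mulVf ?gt_eqF.
Qed.

Lemma unorm_le p (M : R) : 0 <= M -> (forall y, nrm (uact p y) <= M * nrm y) ->
  unorm p <= M.
Proof.
move=> M0 H; apply: ge_sup; first by case: (unorm_sup p).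
move=> _ [y y1 ->]; apply: le_trans (H y) _.
by rewrite -[leRHS]mulr1; exact: ler_wpM2l.
Qed.

Lemma unorm_le_pair p : unorm p <= Normc.normc p.1 + nrm p.2.
Proof.
have n0 := normc_nneg p.1; have n1 := nrm_ge0 hA p.2.
apply: unorm_le => [|y]; first exact: addr_ge0.
rewrite mulrDl -(nrmZ hA); apply: le_trans (nrmD hA _ _) _.
by rewrite lerD2l; exact: nrmM hA _ _.
Qed.

(** A left unit satisfies [e e* = e*], so it is self-adjoint, and taking adjoints makes it a
    two-sided unit. *)
Lemma left_unit_False e : ~ (forall y, mul e y = y).
Proof.
move=> H; apply: hnu; exists e => a.
have se : star e = e.
  by rewrite -[LHS]H -{1}(starK hA e) -(starM hA) H (starK hA).
split=> //; apply: (can_inj (starK hA)).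
by rewrite (starM hA) se H.
Qed.

(* If [1 - c] contracts, iterating [e = c + (1 - c) e] produces a left unit. *)
Lemma contraction_False c (r : R) : 0 <= r -> r < 1 ->
  ~ (forall y, nrm (y - mul c y) <= r * nrm y).
Proof.
move=> r0 r1 H; pose u n := iter n (fun s => c + (s - mul c s)) 0.
pose t n := (1 - r ^+ n) / (1 - r) * nrm c.
have ud n : nrm (u n.+1 - u n) <= t n.+1 - t n.
  have -> : t n.+1 - t n = r ^+ n * nrm c.
    by rewrite /t exprS; field; rewrite gt_eqF // subr_gt0.
  elim: n => [|n IH]; first by rewrite /= (cmul0 hA) !subr0 addr0 mul1r.
  have -> : u n.+2 - u n.+1 = (u n.+1 - u n) - mul c (u n.+1 - u n).
    have -> : u n.+2 - u n.+1 =
      (c + (u n.+1 - mul c (u n.+1))) - (c + (u n - mul c (u n))) by [].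
    by rewrite opprD addrACA subrr add0r (cmulBr hA) !opprB addrACA
      [RHS]addrACA [_ + - u n]addrC.
  by apply: le_trans (H _) _; rewrite exprS -mulrA; apply: ler_wpM2l.
have [e ue] : exists e, cvgs nrm u e.
  apply: (cvgs_majorant hA ud (M := (1 - r)^-1 * nrm c)) => n.
  apply: ler_wpM2r; first exact: nrm_ge0 hA _.
  by rewrite -[leRHS]mul1r ler_pM2r ?invr_gt0 ?subr_gt0 // gerBl exprn_ge0.
have E : e = c + (e - mul c e).
  apply: (cvgs_unique hA (cvgs_shift ue)).
  have ce := cvgs_mull hA (- c) ue; rewrite (cmulNl hA) in ce.
  have := cvgs_add hA (cvgs_cst hA c) (cvgs_add hA ue ce).
  by apply: cvgs_ext => n; rewrite (cmulNl hA).
have ce : mul c e = c.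
  have : e + (c - mul c e) = e + 0 by rewrite addr0 addrCA -E.
  by move/addrI/subr0_eq.
(* As [c e = c], [c] annihilates [y - e y], whose norm is then at most [r < 1] times itself. *)
apply: (@left_unit_False e) => y.
have := H (y - mul e y); rewrite (cmulBr hA) (cmulA hA) ce subrr subr0 => Hy.
have : nrm (y - mul e y) <= 0 by have := nrm_ge0 hA (y - mul e y); nra.
by move/(nrm_le0 hA)/subr0_eq.
Qed.

(** Otherwise [p] divided by its scalar part acts as a contraction [1 - c]. This continuity of the
    scalar part makes [unorm] definite and complete, and [A] closed in the unitization. *)
Lemma normc_le_unorm p : Normc.normc p.1 <= unorm p.
Proof.
rewrite leNgt; apply/negP => lt; have p0 := unorm_ge0 p.
have n0 : 0 < Normc.normc p.1 by exact: le_lt_trans lt.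
have p1 : p.1 != 0 by apply/eqP => E; rewrite E Normc.normc0 ltxx in n0.
apply: (@contraction_False (- ((p.1 : R[i])^-1 *: p.2)) (unorm p / Normc.normc p.1)).
- by rewrite divr_ge0 // ltW.
- by rewrite ltr_pdivrMr // mul1r.
move=> y; rewrite (cmulNl hA) opprK (cmulZl hA).
have -> : y + (p.1 : R[i])^-1 *: mul p.2 y = (p.1 : R[i])^-1 *: uact p y.
  by rewrite /uact scalerDr scalerA mulVf // scale1r.
rewrite (nrmZ hA) Normc.normcV mulrC mulrAC ler_pM2r ?invr_gt0 //.
exact: uact_le.
Qed.

(** The lower bound comes from testing the action on [star a]. *)
Lemma unorm_inj a : unorm (uinj a) = nrm a.
Proof.
apply/eqP; rewrite eq_le; apply/andP; split.
  apply: unorm_le; first exact: nrm_ge0 hA _.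
  by move=> y; rewrite uact_inj; exact: nrmM hA _ _.
have [->|/eqP/(nrm_gt0 hA) a0] := eqVneq a 0; first by rewrite (nrm0 hA) unorm_ge0.
rewrite -(ler_pM2r a0) -expr2 -(nrmC' hA) -[X in _ <= _ * X](nrm_star hA) -uact_inj.
exact: uact_le.
Qed.

Lemma unorm_eq0 p : unorm p = 0 -> p = 0.
Proof.
move=> p0; have p1 : p.1 = 0.
  by apply: Normc.eq0_normc; apply/eqP; rewrite eq_le normc_nneg andbT -p0 normc_le_unorm.
case: p p1 p0 => a v /= -> H; congr (_, _).
by apply: (nrm_eq0 hA); rewrite -H -unorm_inj.
Qed.

Lemma unormD p q : unorm (p + q) <= unorm p + unorm q.
Proof.
apply: unorm_le; first by rewrite addr_ge0 ?unorm_ge0.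
move=> y; rewrite uactD mulrDl; apply: le_trans (nrmD hA _ _) _.
by apply: lerD; exact: uact_le.
Qed.

Lemma unormZ k p : unorm (k *: p) = Normc.normc k * unorm p.
Proof.
have H (c : R[i]) q : unorm (c *: q) <= Normc.normc c * unorm q.
  apply: unorm_le; first by rewrite mulr_ge0 ?unorm_ge0 ?normc_nneg.
  move=> y; rewrite uactZ (nrmZ hA) -mulrA.
  by apply: ler_wpM2l; [exact: normc_nneg | exact: uact_le].
apply/eqP; rewrite eq_le H /=.
have [->|k0] := eqVneq k 0; first by rewrite Normc.normc0 mul0r unorm_ge0.
have nk : 0 < Normc.normc k.
  by rewrite lt_def normc_nneg andbT; apply/eqP => /Normc.eq0_normc/eqP; rewrite (negbTE k0).
rewrite -ler_pdivlMl // -Normc.normcV; apply: le_trans (H _ _).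
by rewrite scalerA mulVf // scale1r.
Qed.

Lemma unormM p q : unorm (p * q) <= unorm p * unorm q.
Proof.
apply: unorm_le; first by rewrite mulr_ge0 ?unorm_ge0.
move=> y; rewrite uactM -mulrA; apply: le_trans (uact_le _ _) _.
by apply: ler_wpM2l; [exact: unorm_ge0 | exact: uact_le].
Qed.

Lemma ustarK p : ustar (ustar p) = p.
Proof. by case: p => a v; rewrite /ustar /= (starK hA) conjcK. Qed.

(** Since [p*] acts as an adjoint ([star_uact]), the square of [nrm (p y)] is the norm of
    [y* (p* p y)], at most [unorm (p* p)] times the square of [nrm y]. *)
Lemma unormC p : unorm (ustar p * p) = unorm p ^+ 2.
Proof.
have le2 q : unorm q ^+ 2 <= unorm (ustar q * q).
  have n0 := unorm_ge0 (ustar q * q).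
  rewrite -[leRHS]sqr_sqrtr // ler_sqr ?nnegrE ?unorm_ge0 ?sqrtr_ge0 //.
  apply: unorm_le; first exact: sqrtr_ge0.
  move=> y; have y0 := nrm_ge0 hA y.
  rewrite -ler_sqr ?nnegrE ?mulr_ge0 ?sqrtr_ge0 ?(nrm_ge0 hA) // exprMn sqr_sqrtr //.
  rewrite -(nrmC hA) star_uact -uactM; apply: le_trans (nrmM hA _ _) _.
  by rewrite (nrm_star hA) expr2 mulrA [leRHS]mulrC; apply: ler_wpM2l => //; exact: uact_le.
have les q : unorm q <= unorm (ustar q).
  have := unorm_ge0 q; rewrite le_eqVlt => /orP[/eqP <-|q0]; first exact: unorm_ge0.
  rewrite -(ler_pM2r q0) -expr2; apply: le_trans (le2 q) _; exact: unormM.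
have eqs : unorm (ustar p) = unorm p.
  by apply/eqP; rewrite eq_le les -{2}(ustarK p) les.
by apply/eqP; rewrite eq_le le2 andbT expr2 -{1}eqs unormM.
Qed.

Lemma unorm_complete : complete_norm (A := U) unorm.
Proof.
move=> u Hu.
have [l Hl] : exists l : R[i], forall e : R, 0 < e -> exists K : nat, forall n,
    (K <= n)%N -> Normc.normc ((u n).1 - l) < e.
  apply: complex_cauchy => e /Hu[K HK]; exists K => m n Km Kn.
  exact: le_lt_trans (normc_le_unorm (u m - u n)) (HK m n Km Kn).
have [_ _ _ hc] := hA.
have [a Ha] : exists a, forall e : R, 0 < e -> exists K : nat, forall n,
    (K <= n)%N -> nrm ((u n).2 - a) < e.
  apply: hc => e e0; have e2 : 0 < e / 2 by lra.
  have [K HK] := Hu _ e2; exists K => m n Km Kn.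
  have -> : (u m).2 - (u n).2 = (u m - u n).2 by [].
  have Hmn := HK m n Km Kn; rewrite -unorm_inj.
  set d := u m - u n in Hmn *.
  have -> : uinj d.2 = d - (d.1 : R[i]) *: (1 : U).
    congr (_, _) => /=; last by rewrite scaler0 subr0.
    by rewrite /GRing.scale /= mulr1 subrr.
  apply: le_lt_trans (unormD _ _) _; rewrite -scaleNr unormZ normcN.
  have ud := normc_le_unorm d.
  have u1 : unorm 1 <= Normc.normc (1 : R[i]) + nrm 0 := unorm_le_pair (1 : U).
  rewrite Normc.normc1 (nrm0 hA) addr0 in u1.
  have := normc_nneg (d.1 : R[i]); nra.
exists (l, a) => e e0; have e2 : 0 < e / 2 by lra.
have [K HK] := Hl _ e2; have [L HL] := Ha _ e2; exists (maxn K L) => n.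
rewrite geq_max => /andP[/HK Hn /HL Hn']; apply: le_lt_trans (unorm_le_pair _) _.
rewrite /=; lra.
Qed.

Lemma unitization_cstar : is_cstar_algebra (A := U) *%R ustar unorm.
Proof.
split.
- split; [exact: mulrA | exact: mulrDl | exact: mulrDr | |].
    by move=> k p q; rewrite scalerAl.
  by move=> k p q; rewrite scalerAr.
- split.
  + by move=> p q; rewrite /ustar /= rmorphD (starD hA).
  + by move=> k p; rewrite /ustar /= (starZ hA); congr (_, _); exact: rmorphM.
  + exact: ustarK.
  + move=> [a v] [b w]; congr (_, _) => /=; first by rewrite rmorphM mulrC.
    rewrite !(starD hA) !(starZ hA) (starM hA); congr (_ + _); exact: addrC.
- split; [exact: unorm_eq0 | exact: unormD | exact: unormZ | exact: unormM | exact: unormC].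
- exact: unorm_complete.
Qed.

Definition uideal (p : U) : Prop := p.1 = 0.

Lemma uideal_closed : closed_ideal ustar unorm uideal.
Proof.
split.
- by move=> p q /= p0 q0; rewrite /uideal /= p0 q0 addr0.
- by move=> p q q0; rewrite /uideal /= q0; exact: mulr0.
- by move=> p q p0; rewrite /uideal /= p0; exact: mul0r.
- by move=> p p0; rewrite /uideal /= p0 conjc0.
- move=> u l ul u0; apply: Normc.eq0_normc; apply/eqP; rewrite eq_le normc_nneg andbT.
  apply: (@le0_of_small _ _ 1) => e /ul[K /(_ K (leqnn _)) HK]; rewrite mul1r.
  apply: ltW; apply: le_lt_trans HK; apply: le_trans (normc_le_unorm _).
  by rewrite /= u0 sub0r normcN.
Qed.

Lemma uinj_ideal a : uideal (uinj a). Proof. by []. Qed.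
Lemma uideal_inj p : uideal p -> p = uinj p.2.
Proof. by case: p => c a; rewrite /uideal /= => ->. Qed.
Lemma uinj_injective a b : uinj a = uinj b -> a = b. Proof. by case. Qed.
Lemma uinjD a b : uinj (a + b) = uinj a + uinj b.
Proof. by congr (_, _); rewrite /= addr0. Qed.
Lemma uinjB a b : uinj (a - b) = uinj a - uinj b.
Proof. by congr (_, _); rewrite /= subr0. Qed.
Lemma uinjM a b : uinj (mul a b) = uinj a * uinj b.
Proof. by congr (_, _); rewrite /= ?mul0r // !scale0r !add0r. Qed.
Lemma uinj_star a : uinj (star a) = ustar (uinj a).
Proof. by congr (_, _); apply/esym/conjc0. Qed.

End UnitizationNorm.

(** * Right ideals and pure states *)

Section RightInvertibility.
Variables (R : realType) (A : lmodType R[i]).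
Variables (mul : A -> A -> A) (star : A -> A) (nrm : A -> R).
Hypothesis hA : is_cstar_algebra mul star nrm.

Definition dense_multiples (x : A) : Prop :=
  forall y (e : R), 0 < e -> exists r, nrm (mul x r - y) < e.

(** The definition takes real and imaginary parts as elements of [R[i]]; here they become real
    numbers. *)
Lemma positive_functionalP tau a : positive_functional mul star tau ->
  complex.Im (tau (mul (star a) a)) = 0 /\ 0 <= complex.Re (tau (mul (star a) a)).
Proof.
move=> [_ /(_ a)]; rewrite -complexRe -complexIm ler0c => -[+ H].
by move=> /(@complexI _ _ 0).
Qed.

(* Degenerate Cauchy-Schwarz: apply positivity to [s x* + l z] for all real [s]
   and [l = 1, i]. *)
Lemma positive_functional_null tau x z : positive_functional mul star tau ->
  tau (mul x (star x)) = 0 -> tau (mul x z) = 0.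
Proof.
move=> pt x0; have [[tD tZ] _] := pt.
pose u := tau (mul x z); pose v := tau (mul (star z) (star x)).
pose w := tau (mul (star z) z).
have E (s : R) (l : R[i]) : conjc l * l = 1 ->
    tau (mul (star (s%:c *: star x + l *: z)) (s%:c *: star x + l *: z)) =
    s%:c * (l * u + conjc l * v) + w.
  move=> l1; rewrite (starD hA) !(starZ hA) (starK hA) conjc_real.
  rewrite !(cmulDl hA) !(cmulDr hA) !(cmulZl hA) !(cmulZr hA) !tD !tZ x0 -/u -/v -/w.
  by rewrite !mulr0 add0r -[X in _ = _ + X]mul1r -l1; ring.
have key l : conjc l * l = 1 -> l * u + conjc l * v = 0.
  move=> l1; have H s := positive_functionalP (s%:c *: star x + l *: z) pt.
  have [w0 w1] := positive_functionalP z pt; rewrite -/w in w0 w1.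
  set c := _ + _.
  have {}H (s : R) : s * complex.Im c = 0 /\ 0 <= s * complex.Re c + complex.Re w.
    have := H s; rewrite (E s l l1) -/c; case: (c) (w) w0 w1 => a b [a' b'] /= -> _.
    by move=> [H1 H2]; split; lra.
  have [im _] := H 1; rewrite mul1r in im.
  have re : complex.Re c = 0.
    apply/eqP/negPn/negP => c0.
    have [_] := H (- (1 + complex.Re w) / complex.Re c).
    by rewrite mulfVK //; lra.
  by case: (c) im re => a b /= -> ->.
have k1 := key 1; have ki := key 'i%C.
have e1 : conjc (1 : R[i]) * 1 = 1 by rewrite conjc1 mulr1.
have ei : conjc ('i%C : R[i]) * 'i%C = 1.
  by apply/eqP; rewrite eq_complex /=; apply/andP; split; apply/eqP; ring.
move: (k1 e1) (ki ei); rewrite -/u; case: (u) => a b; case: (v) => c d /=.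
move=> /eqP; rewrite eq_complex /= => /andP[/eqP H1 /eqP H2].
move=> /eqP; rewrite eq_complex /= => /andP[/eqP H3 /eqP H4].
by apply/eqP; rewrite eq_complex /=; apply/andP; split; apply/eqP; lra.
Qed.

Lemma approx_right_invertible_dense x :
  approx_right_invertible mul nrm x -> dense_multiples x.
Proof.
move=> [I [le [r [[_ lexx _ _] H]]]] y e /((H y).1 e)[j /(_ j (lexx j)) Hj].
by exists (mul (r j) y); rewrite (cmulA hA).
Qed.

Lemma dense_not_null x tau : dense_multiples x ->
  is_state mul star nrm tau -> tau (mul x (star x)) <> 0.
Proof.
move=> dx [pt t1 t2] x0.
(* [tau a] has modulus above 1/2, yet it equals [- tau (x r - a)], of modulus below 1/2. *)
have h0 : 0 < (2^-1 : R) by rewrite invr_gt0.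
have [a [_ Ha]] := t2 _ h0; have [r Hr] := dx a _ h0.
have [[tD tZ] _] := pt.
have E : tau (mul x r - a) = - tau a.
  by rewrite tD -scaleN1r tZ (positive_functional_null _ pt x0) add0r mulN1r.
by have := t1 (mul x r - a); rewrite E normcN; lra.
Qed.

Section MaximalIdeal.
Variables (N : A -> Prop) (v : A).
Hypotheses (rN : right_ideal mul N) (Nv : forall y, N (mul v y - y)) (nNv : ~ N v).

(** Zorn's lemma runs over right ideals avoiding [v], a condition that survives unions of chains. It
    amounts to properness: an ideal containing [v] and all [v b - b] contains every [b]. *)
Lemma maximal_modular_exists :
  exists I, maximal_modular_right_ideal mul I /\ forall a, N a -> I a.
Proof.
pose ok I := [/\ right_ideal mul I, forall a, N a -> I a & ~ I v].
pose T := {I : A -> Prop | ok I}.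
pose le (I J : T) := `[< forall a, sval I a -> sval J a >].
have okN : ok N by split.
have [|||[I [rI NI nI]] Imax] := @ZL_preorder T (exist _ N okN) le.
- by move=> I; apply/asboolP.
- by move=> I J K /asboolP IJ /asboolP JK; apply/asboolP => a /IJ/JK.
- move=> C totC; have [[I0 CI0]|C0] := pselect (exists I, C I); last first.
    by exists (exist _ N okN) => s Cs; case: C0; exists s.
  pose M a := exists2 I : T, C I & sval I a.
  have okM : ok M.
    split.
    + split.
      * by exists I0 => //; have [[]] := svalP I0.
      * move=> a b [I CI Ia] [J CJ Jb].
        have [/asboolP IJ|/asboolP JI] := totC _ _ CI CJ.
          by exists J => //; have [[_ JD _ _] _ _] := svalP J; apply: JD => //; exact: IJ.
        by exists I => //; have [[_ ID _ _] _ _] := svalP I; apply: ID => //; exact: JI.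
      * by move=> k a [I CI Ia]; exists I => //; have [[_ _ IZ _] _ _] := svalP I; exact: IZ.
      * by move=> a y [I CI Ia]; exists I => //; have [[_ _ _ IM] _ _] := svalP I; exact: IM.
    + by move=> a Na; exists I0 => //; have [_ H _] := svalP I0; exact: H.
    + by move=> [I _]; have [_ _] := svalP I.
  by exists (exist _ M okM) => I CI; apply/asboolP => a Ia; exists I.
exists I; split=> //; split=> //; first by exists v.
  by exists v => y; apply/NI/Nv.
move=> J rJ [b nJb] IJ; have [J0 JD JZ JM] := rJ.
have okJ : ok J.
  split=> // [a /NI/IJ //|Jv]; apply: nJb.
  have -> : b = mul v b + (-1) *: (mul v b - b).
    by rewrite scaleN1r opprB addrC subrK.
  by apply: JD; [exact: JM | apply: JZ; apply/IJ/NI/Nv].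
by have /asboolP := Imax (exist _ J okJ) (asboolT IJ).
Qed.

End MaximalIdeal.

Hypothesis hnu : non_unital mul.
Local Notation U := (unitization hA).
Local Notation st := (@ustar R A mul star nrm hA).
Local Notation NU := (@unorm R A mul star nrm hA).
Local Notation inj := (uinj hA).
Let hU : is_cstar_algebra (A := U) *%R st NU := unitization_cstar hA hnu.
Let hJ : closed_ideal st NU (@uideal R A mul star nrm hA) := uideal_closed hA hnu.

(** [c = b (1 - b)^-1]; the inverse lives in the unitization, but the product lies in the ideal
    [A]. *)
Lemma quasi_inverse b : nrm b < 1 -> exists c, c = b + mul b c.
Proof.
rewrite -(unorm_inj hA) => /(neumann hU)[u [u1 _ _]].
have /uideal_inj E : uideal (inj b * u) by case: hJ => _ _ H _ _; apply: H.
exists (inj b * u).2; apply: (uinj_injective (hA := hA)).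
rewrite uinjD uinjM -E.
have H : inj b * u = inj b * ((1 - inj b) * u) + inj b * (inj b * u) by ncring.
by rewrite u1 mulr1 in H.
Qed.

Lemma dense_not_in_ideal x I :
  dense_multiples x ->
  maximal_modular_right_ideal mul I -> ~ I x.
Proof.
move=> dx [[I0 ID IZ IM] [a nIa] [v Hv] _] Ix.
have [r Hr] := dx v 1 ltr01; rewrite (nrm_dist hA) in Hr.
have [c Hc] := quasi_inverse Hr; set i0 := mul x r in Hc.
have Ii0 : I i0 by exact: IM.
have IN b : I b -> I (- b) by move=> Ib; rewrite -scaleN1r; exact: IZ.
have Ib : I (v - i0).
  (* With [b = v - i0] and [c = b + b c], one has [b = c - b c = i0 c - (v c - c)], a difference of
     members of [I]. *)
  have -> : v - i0 = mul i0 c - (mul v c - c).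
    have E : mul (v - i0) c = mul v c - mul i0 c := cmulBl hA v i0 c.
    have -> : v - i0 = c - mul (v - i0) c by rewrite {1}Hc addrK.
    by rewrite E !opprB addrCA addrC.
  by apply: ID; [exact: IM | exact: IN].
have Iv : I v by rewrite -(subrK i0 v); exact: ID.
apply: nIa; have -> : a = mul v a - (mul v a - a) by rewrite subKr.
by apply: ID; [exact: IM | exact: IN].
Qed.

End RightInvertibility.

(** * The approximate identity and the pure state obtained from [k] *)

Section SeparatingPureState.
Variables (R : realType) (A : lmodType R[i]).
Variables (mul : A -> A -> A) (star : A -> A) (nrm : A -> R).
Hypothesis hA : is_cstar_algebra mul star nrm.
Hypothesis hnu : non_unital mul.
Local Notation U := (unitization hA).
Local Notation st := (@ustar R A mul star nrm hA).
Local Notation NU := (@unorm R A mul star nrm hA).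
Local Notation inj := (uinj hA).
Local Notation J := (@uideal R A mul star nrm hA).
Let hU : is_cstar_algebra (A := U) *%R st NU := unitization_cstar hA hnu.
Let hJ : closed_ideal st NU J := uideal_closed hA hnu.

Definition rescaled (x : A) : A := ((1 + nrm x)^-1)%:c *: x.

Lemma rescale_gt0 (x : A) : 0 < (1 + nrm x)^-1.
Proof. by rewrite invr_gt0; have := nrm_ge0 hA x; lra. Qed.

Lemma N_rescaled x : NU (inj (rescaled x)) <= 1.
Proof.
rewrite (unorm_inj hA) (nrmZr hA) gtr0_norm ?rescale_gt0 // mulrC ler_pdivrMr.
  by have := nrm_ge0 hA x; lra.
by have := nrm_ge0 hA x; lra.
Qed.

Lemma dense_approx_right_invertible x :
  dense_multiples mul nrm x ->
  approx_right_invertible mul nrm x.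
Proof.
move=> dx; pose c := (1 + nrm x)^-1; have c0 : 0 < c := rescale_gt0 x.
pose X := inj (rescaled x); have X1 : NU X <= 1 := N_rescaled x.
pose q n := approx_inv st X n.
have Jq n : J (q n).
  by have [_ _ Jr Js _] := hJ; apply: Jr; apply: Js; exact: uinj_ideal.
pose r n := c%:c *: (q n).2.
have xr n : inj (mul x (r n)) = 1 - defect st X n.
  rewrite -(mul_approx_inv st) -/(q n) [q n in RHS](uideal_inj (Jq n)) -uinjM.
  by congr (inj _); rewrite /rescaled (cmulZl hA) (cmulZr hA).
exists nat, (fun m n => (m <= n)%N : Prop), r; split.
  split; [exact: (inhabits 0%N) | by [] | by move=> i j k; exact: leq_trans |].
  by move=> i j; exists (maxn i j); rewrite leq_maxl leq_maxr.
have left y : cvgs NU (fun n => (1 - defect st X n) * inj y) (inj y).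
  apply: (defect_cvg_dense hU X1) => e e0; have [s Hs] := dx y e e0.
  exists (inj (c^-1%:c *: s)); rewrite -uinjM -uinjB (unorm_inj hA).
  rewrite /rescaled (cmulZl hA) (cmulZr hA) scalerA -realC_M mulfV ?gt_eqF //.
  by rewrite scale_real1.
move=> y; split=> e e0.
  have [K HK] := left y e e0; exists K => n /HK.
  by rewrite -xr -uinjM -uinjB (unorm_inj hA).
(* [1 - G n] is self-adjoint, so right convergence at [y] is the adjoint of left convergence at
   [star y]. *)
have [K HK] := left (star y) e e0; exists K => n /HK.
rewrite -(nrm_star hU) (starB hU) (starM hU) (starB hU) (st1 hU).
have [-> _] := pos_defect hU X1 n.
by rewrite -xr -uinj_star (starK hA) -uinjM -uinjB (unorm_inj hA).
Qed.

Lemma not_dense_exposing x : ~ dense_multiples mul nrm x ->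
  exists k : A, [/\ pos st NU (inj k), nrm k = 1 &
    pos st NU (1 - (inj k + inj (mul (rescaled x) (star (rescaled x)))))].
Proof.
move=> nd; have [y [d d0 Hd]] : exists y,
    exists2 d : R, 0 < d & forall r, d <= nrm (mul x r - y).
  apply: contrapT => H; apply: nd => y e e0; apply: contrapT => H'.
  apply: H; exists y, e => // r; rewrite leNgt; apply/negP => lt; apply: H'.
  by exists r.
have X1 := N_rescaled x; set X := inj (rescaled x) in X1.
have low n : d <= NU (defect st X n * inj y).
  have -> : defect st X n * inj y = inj y - X * (approx_inv st X n * inj y).
    by rewrite mulrA mul_approx_inv; ncring.
  have /uideal_inj -> : J (approx_inv st X n * inj y).
    by have [_ Jl _ _ _] := hJ; apply: Jl; exact: uinj_ideal.
  rewrite -uinjM -uinjB (unorm_inj hA) (nrm_dist hA) /rescaled (cmulZl hA) -(cmulZr hA).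
  exact: Hd.
have [k [Jk pk k1 p1]] := exposing_element hU X1 hJ (uinj_ideal hA y) d0 low.
have Ek := uideal_inj Jk; rewrite Ek in pk k1 p1.
exists k.2; split=> //; first by rewrite -(unorm_inj hA).
by rewrite uinjM uinj_star.
Qed.

Lemma not_dense_pure_state x : ~ dense_multiples mul nrm x ->
  exists (tau : A -> R[i]) (k : A), [/\ pure_state mul star nrm tau,
    tau (mul x (star x)) = 0, forall w z, tau (mul (mul k w - w) z) = 0 &
    tau (mul k k) <> 0].
Proof.
move=> /not_dense_exposing[k [pk k1 pkx]].
have snrm : sublinear nrm.
  split; first exact: nrmD hA.
  by move=> r a r0; rewrite (nrmZr hA) gtr0_norm.
have [phi [[phiD phiZ] phile phik ext]] := extreme_functional snrm k.
have phiN a : phi (- a) = - phi a by apply: real_linearN.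
(* Extending by 0 on the scalars gives no norm bound outside [A], hence the ideal [J] in the lemmas
   on exposed functionals. *)
pose Phi (b : U) := phi b.2.
have PhiD (a b : U) : Phi (a + b) = Phi a + Phi b by exact: phiD.
have PhiZ (r : R) (a : U) : Phi (r%:c *: a) = r * Phi a by exact: phiZ.
have Phile a : J a -> Phi a <= NU a.
  by move=> /uideal_inj ->; rewrite (unorm_inj hA); exact: phile.
have Jk : J (inj k) by [].
have Phik : Phi (inj k) = 1 by rewrite /Phi /= phik.
set h := mul (rescaled x) _ in pkx.
have ph : pos st NU (inj h) by rewrite uinjM uinj_star; exact: (pos_mul_star hU).
have p1k : pos st NU (1 - inj k).
  have -> : 1 - inj k = (1 - (inj k + inj h)) + inj h by ncring.
  exact: (posD hU).
have posPhi := exposed_pos hU hJ PhiD PhiZ Phile Jk pk p1k Phik.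
have imPhi := exposed_i_sa hU hJ PhiD PhiZ Phile Jk pk p1k Phik.
have mulPhi w := exposed_mul1B hU hJ PhiD PhiZ Phile Jk pk p1k Phik (w := w).
pose tau a : R[i] := Complex (phi a) (- phi ('i%C *: a)).
have phiC (z : R[i]) a : phi (z *: a) =
    complex.Re z * phi a + complex.Im z * phi ('i%C *: a).
  case: z => c d /=; rewrite -!phiZ -phiD scalerA -scalerDl; congr (phi (_ *: _)).
  by apply/eqP; rewrite eq_complex /=; apply/andP; split; apply/eqP; ring.
have tau_lin : linear_functional tau.
  split=> [a b|z a]; apply/eqP; rewrite eq_complex /=; apply/andP; split; apply/eqP => //.
  - by rewrite scalerDr phiD opprD.
  - by rewrite phiC; case: (z) => c d /=; ring.
  - by rewrite scalerA phiC; case: (z) => c d /=; ring.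
have tau_star a : 0 <= phi (mul (star a) a) /\ phi ('i%C *: mul (star a) a) = 0.
  have ps : pos st NU (inj (mul (star a) a)).
    by rewrite uinjM uinj_star; exact: (pos_star_mul hU).
  by split; [exact: posPhi (uinj_ideal hA _) ps | apply: imPhi (uinj_ideal hA _) ps.1].
have tau_pos : positive_functional mul star tau.
  split=> // a; have [H1 H2] := tau_star a.
  by rewrite -complexRe -complexIm /= H2 oppr0 ler0c.
have tau_le a : Normc.normc (tau a) <= nrm a.
  have [z0|z0] := eqVneq (tau a) 0; first by rewrite z0 Normc.normc0 (nrm_ge0 hA).
  pose p := phi a; pose q := phi ('i%C *: a).
  have nE : Normc.normc (tau a) = Num.sqrt (p ^+ 2 + q ^+ 2) by rewrite /= sqrrN.
  set n := Normc.normc (tau a) in nE *.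
  have n2 : n ^+ 2 = p ^+ 2 + q ^+ 2.
    by rewrite nE sqr_sqrtr // addr_ge0 ?sqr_ge0.
  have n0 : n != 0 by apply: contra_neq z0 => /Normc.eq0_normc.
  (* Rotating [a] by the conjugate phase of [tau a] makes [phi] take the value [n]. *)
  have := phile (Complex (p / n) (q / n) *: a); rewrite phiC (nrmZ hA) /= -/p -/q.
  have -> : p / n * p + q / n * q = n.
    by rewrite mulrAC [q / n * q]mulrAC -mulrDl -!expr2 -n2 expr2 mulfK.
  by rewrite !expr_div_n -mulrDl -n2 divff ?sqrf_eq0 // sqrtr1 mul1r.
have tau_state : is_state mul star nrm tau.
  split=> // e e0; exists k; rewrite k1; split=> //.
  have [+ _] := normc_ge_ReIm (tau k); rewrite /= phik k1 normr1; lra.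
exists tau, k; split.
- split=> // t t1 t2 t0 t1' s1 s2 E.
  (* Purity reduces to extremality of [phi]: real parts of states are real-linear and below the
     norm, and they determine the imaginary parts through multiplication by [i]. *)
  have lin (s : A -> R[i]) : is_state mul star nrm s ->
      real_linear (fun a => complex.Re (s a)) /\ dominated (fun a => complex.Re (s a)) nrm.
    move=> [[[sD sZ] _] sle _]; split; first split=> [a b|r a].
    + by rewrite sD; case: (s a) => ? ?; case: (s b).
    + by rewrite sZ; case: (s a) => ? ? /=; rewrite mul0r subr0.
    + move=> a; apply: le_trans (sle a); have [+ _] := normc_ge_ReIm (s a).
      exact/le_trans/ler_norm.
  have [l1 d1] := lin _ s1; have [l2 d2] := lin _ s2.
  have H := ext _ _ t t0 t1' l1 l2 d1 d2.
  have {}H a : complex.Re (t1 a) = phi a /\ complex.Re (t2 a) = phi a.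
    apply: H => b; have := E b; rewrite /tau.
    by case: (t1 b) => ? ?; case: (t2 b) => ? ? /= [-> _]; rewrite !mul0r !subr0.
  have im (s : A -> R[i]) a : is_state mul star nrm s ->
      complex.Im (s a) = - complex.Re (s ('i%C *: a)).
    by move=> [[[_ sZ] _] _ _]; rewrite sZ; case: (s a) => c d /=; ring.
  move=> a; split; apply/eqP; rewrite eq_complex /= im //.
    by have [-> _] := H a; have [-> _] := H ('i%C *: a); rewrite !eqxx.
  by have [_ ->] := H a; have [_ ->] := H ('i%C *: a); rewrite !eqxx.
- have h0 := exposed_zero hU hJ PhiD PhiZ Phile Jk pk p1k Phik (uinj_ideal hA h) ph pkx.
  have hE : h = ((1 + nrm x)^-1 * (1 + nrm x)^-1)%:c *: mul x (star x).
    by rewrite /h /rescaled (starZr hA) (cmulZl hA) (cmulZr hA) scalerA -realC_M.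
  move: h0; rewrite /Phi /= hE phiZ => /eqP; rewrite mulf_eq0 mulf_eq0 orbb.
  rewrite gt_eqF ?rescale_gt0 //= => /eqP phi0.
  have [_] := tau_star (star x); rewrite (starK hA) /tau => ->.
  by rewrite phi0 oppr0.
- have H w z : phi (mul (mul k w - w) z) = 0.
    have [+ _] := mulPhi (inj (mul w z)) (uinj_ideal hA _).
    have -> : (1 - inj k) * inj (mul w z) = - inj (mul (mul k w - w) z).
      by rewrite !uinjM uinjB uinjM; ncring.
    by rewrite /Phi /= phiN => /eqP; rewrite oppr_eq0 => /eqP.
  by move=> w z; rewrite /tau -(cmulZr hA) !H oppr0.
(* The value 1 at [k k] keeps [k] out of the right ideal of all [y] with [tau (y A) = 0], which
   makes that ideal proper. *)
- have := exposed_kk hU hJ PhiD PhiZ Phile Jk pk p1k Phik.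
  rewrite -uinjM /Phi /= => kk [kk0 _].
  by have := oner_neq0 R; rewrite -kk kk0 eqxx.
Qed.

End SeparatingPureState.

Local Unset Implicit Arguments.
Local Set Strict Implicit.

Theorem theorem3p6 (R : realType) (A : lmodType R[i])
    (mul : A -> A -> A) (star : A -> A) (nrm : A -> R)
    (hA : is_cstar_algebra mul star nrm)
    (hnu : non_unital mul) (hna : non_abelian mul) (x : A) :
  (approx_right_invertible mul nrm x <->
     (forall I : A -> Prop, maximal_modular_right_ideal mul I -> ~ I x)) /\
  ((forall I : A -> Prop, maximal_modular_right_ideal mul I -> ~ I x) <->
     (forall tau : A -> R[i], pure_state mul star nrm tau ->
        tau (mul x (star x)) <> 0)).
Proof.
pose dense := dense_multiples mul nrm x.
have dI : dense -> forall I, maximal_modular_right_ideal mul I -> ~ I x.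
  by move=> dx I; exact: (dense_not_in_ideal hA hnu dx).
have dt : dense -> forall tau, pure_state mul star nrm tau ->
    tau (mul x (star x)) <> 0.
  by move=> dx tau [st _]; exact: (dense_not_null hA dx st).
have td : (forall tau, pure_state mul star nrm tau ->
    tau (mul x (star x)) <> 0) -> dense.
  move=> H; apply: contrapT => /(not_dense_pure_state hA hnu)[tau [k [pt x0 _ _]]].
  exact: H pt x0.
have Id : (forall I, maximal_modular_right_ideal mul I -> ~ I x) -> dense.
  move=> H; apply: contrapT => /(not_dense_pure_state hA hnu)[tau [k [pt x0 kw kk]]].
  have [[[[tD tZ] _] _ _] _] := pt; have [[tp _ _] _] := pt.
  pose N a := forall z, tau (mul a z) = 0.
  have rN : right_ideal mul N.
    split=> [z|a b Na Nb z|c a Na z|a y Na z].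
    - by rewrite -(scale0r (0 : A)) (cmulZl hA) tZ mul0r.
    - by rewrite (cmulDl hA) tD Na Nb addr0.
    - by rewrite (cmulZl hA) tZ Na mulr0.
    - by rewrite -(cmulA hA).
  have [I [mI NI]] := maximal_modular_exists (v := k) rN
    (fun y z => kw y z) (fun Nk => kk (Nk k)).
  by apply: (H I mI); apply: NI => z; exact: (positive_functional_null hA z tp x0).
have ad : approx_right_invertible mul nrm x -> dense.
  exact: (approx_right_invertible_dense hA).
have da : dense -> approx_right_invertible mul nrm x.
  exact: (dense_approx_right_invertible hA hnu).
by split; split => H; [apply/dI/ad | apply/da/Id | apply/dt/Id | apply/dI/td].
Qed.
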